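(* Let $X,U,Y$ be real Hilbert spaces and let $A,f,g,h,C,S$ be as in the context. Suppose that the semiglobal input-to-state stability assumption (ISS) and the invariant graph assumption (IG) of the context hold, and let $\mathcal{M}$ be the map provided by (IG). Suppose that $$\operatorname{Range}\,\mathrm{d}\mathcal{M}(0)g(0)=Y.$$ Then the zero equilibrium is locally exponentially stable in $X\times Y$ for the closed-loop system $$\dot{x} = Ax + f(x) + g(x)u,\qquad \dot{z} = Sz + Cx + h(x),\qquad u = g(x)^*\,\mathrm{d}\mathcal{M}(x)^*[z - \mathcal{M}(x)].$$
   Context: Conventions. $\mathcal{L}(E_1,E_2)$ is the space of bounded linear operators between normed spaces, with the operator norm; $\mathcal{C}^1(E_1,E_2)$ is the space of continuously Fréchet differentiable maps, with differential $\mathrm{d}f: E_1\to\mathcal{L}(E_1,E_2)$. A map is called locally Lipschitz continuous if it is Lipschitz continuous on every bounded subset. $L^*$ denotes the Hilbert adjoint of $L$. Data. $A:\mathcal{D}(A)\to X$ is the infinitesimal generator of a strongly continuous semigroup $\{e^{tA}\}_{t\geq 0}$ on $X$, and $\mathcal{D}(A)$ carries the graph norm; $f:X\to X$ is locally Lipschitz continuous with $f(0)=0$; $g:X\to\mathcal{L}(U,X)$ is locally Lipschitz continuous; $h:X\to Y$ is locally Lipschitz continuous with $h(0)=0$; $C\in\mathcal{L}(\mathcal{D}(A),Y)$; $S\in\mathcal{L}(Y)$ is skew-adjoint, $S^*=-S$. A functional $V\in\mathcal{C}^1(X,\mathbb{R})$ is quadratic-like if there exist $m_1,m_2>0$ with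 $m_1\|x\|_X^2\leq V(x)\leq m_2\|x\|_X^2$ for all $x\in X$. (ISS) There exist a quadratic-like $V\in\mathcal{C}^1(X,\mathbb{R})$ and $\beta>0$ such that $\mathrm{d}V(x)[Ax+f(x)+g(x)u]\leq\beta\|u\|_U^2$ for all $x\in\mathcal{D}(A)$, $u\in U$. Moreover, for any bounded open set $\mathcal{B}\subset X$ there exist a quadratic-like $V_{\mathcal{B}}\in\mathcal{C}^1(X,\mathbb{R})$ and $\alpha_{\mathcal{B}},\beta_{\mathcal{B}}>0$ such that $\mathrm{d}V_{\mathcal{B}}(x)[Ax+f(x)+g(x)u]\leq-\alpha_{\mathcal{B}}V_{\mathcal{B}}(x)+\beta_{\mathcal{B}}\|u\|_U^2$ for all $x\in\mathcal{D}(A)\cap\mathcal{B}$, $u\in U$. (IG) There exists $\mathcal{M}\in\mathcal{C}^1(X,Y)$ with $\mathrm{d}\mathcal{M}$ locally Lipschitz continuous such that $\mathcal{M}(0)=0$ and $\mathrm{d}\mathcal{M}(x)(Ax+f(x))=S\mathcal{M}(x)+Cx+h(x)$ for all $x\in\mathcal{D}(A)$. Solutions. Under these assumptions the closed-loop system has a unique global mild solution $[x,z]\in\mathcal{C}([0,\infty),X\times Y)$ for each $[x_0,z_0]\in X\times Y$, where the closed loop is viewed as a locally Lipschitz perturbation of the strongly continuous semigroup on $X\times Y$ generated by $[x,z]\mapsto[Ax,Cx]$ with domain $\mathcal{D}(A)\times Y$; mild solutions are those of the corresponding variation-of-constants formula, they depend continuously on the initial data uniformly on compact time intervals, and they are classical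 if $[x_0,z_0]\in\mathcal{D}(A)\times Y$. Local exponential stability of the zero equilibrium means: there exist $\delta,K,\omega>0$ such that every solution with $\|[x_0,z_0]\|_{X\times Y}<\delta$ satisfies $\|[x(t),z(t)]\|_{X\times Y}\leq Ke^{-\omega t}\|[x_0,z_0]\|_{X\times Y}$ for all $t\geq0$. *)

(* Defs.v *)
From Stdlib Require Import Reals Lra Psatz.
From Stdlib Require Import ProofIrrelevance FunctionalExtensionality ClassicalEpsilon.
From Coquelicot Require Import Coquelicot.
Open Scope R_scope.

Lemma norm_scal_R_eq {E : NormedModule R_AbsRing} (k : R) (x : E) :
  norm (scal k x) = Rabs k * norm x.
Proof.
apply Rle_antisym; [exact (norm_scal k x)|].
destruct (Req_dec k 0) as [->|Hk].
- rewrite Rabs_R0, Rmult_0_l; apply norm_ge_0.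
- pose proof (norm_scal (/ k : R_AbsRing) (scal (k : R_AbsRing) x)) as H.
  rewrite scal_assoc in H.
  replace (mult (/ k : R_AbsRing) (k : R_AbsRing)) with (one : R_AbsRing) in H
    by (change (1 = / k * k); field; exact Hk).
  rewrite scal_one in H. change (abs (/ k)) with (Rabs (/ k)) in H.
  rewrite Rabs_inv in H.
  assert (0 < Rabs k) by (apply Rabs_pos_lt; exact Hk).
  apply (Rmult_le_compat_l (Rabs k)) in H; [|lra].
  rewrite <- Rmult_assoc, Rinv_r, Rmult_1_l in H by lra.
  exact H.
Qed.

Record Lop (E1 E2 : NormedModule R_AbsRing) := mkLop
  { Lop_fun :> E1 -> E2;
    Lop_linear : is_linear Lop_fun }.
Arguments mkLop {E1 E2} _ _.
Arguments Lop_fun {E1 E2} _ _.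
Arguments Lop_linear {E1 E2} _.

Section OperatorSpace.
Context {E1 E2 : NormedModule R_AbsRing}.
Implicit Types L M : Lop E1 E2.

Lemma Lop_ext L M : (forall x, L x = M x) -> L = M.
Proof.
destruct L as [l hl], M as [m hm]; simpl; intros H.
assert (l = m) as Hlm by (apply functional_extensionality; exact H).
subst m; f_equal; apply proof_irrelevance.
Qed.

Definition Lop_plus L M : Lop E1 E2.
Proof.
refine (mkLop (fun x => plus (L x) (M x)) _).
apply (is_linear_comp (fun x => (L x, M x)) (fun p => plus (fst p) (snd p))).
- apply is_linear_prod; apply Lop_linear.
- apply is_linear_plus.
Defined.

Definition Lop_opp L : Lop E1 E2.
Proof.
refine (mkLop (fun x => opp (L x)) _).
apply (is_linear_comp (fun x => L x) opp); [apply Lop_linear|apply is_linear_opp].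
Defined.

Definition Lop_zero : Lop E1 E2 := mkLop (fun _ => zero) is_linear_zero.

Definition Lop_scal (k : R) L : Lop E1 E2.
Proof.
refine (mkLop (fun x => scal k (L x)) _).
apply (is_linear_comp (fun x => L x) (scal k)); [apply Lop_linear|].
apply (is_linear_scal_r (V := E2) (k : R_AbsRing)); intros n; apply Rmult_comm.
Defined.

Definition Lop_AbelianMonoid_mixin : AbelianMonoid.mixin_of (Lop E1 E2).
Proof.
refine (AbelianMonoid.Mixin _ Lop_plus Lop_zero _ _ _).
- intros; apply Lop_ext; intro; apply plus_comm.
- intros; apply Lop_ext; intro; apply plus_assoc.
- intros; apply Lop_ext; intro; apply plus_zero_r.
Defined.
Canonical Lop_AbelianMonoid := AbelianMonoid.Pack _ Lop_AbelianMonoid_mixin (Lop E1 E2).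

Definition Lop_AbelianGroup_mixin : AbelianGroup.mixin_of Lop_AbelianMonoid.
Proof.
refine (AbelianGroup.Mixin _ Lop_opp _).
intros; apply Lop_ext; intro; apply (plus_opp_r (G := E2)).
Defined.
Canonical Lop_AbelianGroup :=
  AbelianGroup.Pack _ (AbelianGroup.Class _ _ Lop_AbelianGroup_mixin) (Lop E1 E2).

Definition Lop_ModuleSpace_mixin : ModuleSpace.mixin_of R_Ring Lop_AbelianGroup.
Proof.
refine (ModuleSpace.Mixin R_Ring _ Lop_scal _ _ _ _).
- intros; apply Lop_ext; intro; apply (scal_assoc (V := E2)).
- intros; apply Lop_ext; intro; apply (scal_one (V := E2)).
- intros; apply Lop_ext; intro; apply (scal_distr_l (V := E2)).
- intros; apply Lop_ext; intro; apply (scal_distr_r (V := E2)).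
Defined.
Canonical Lop_ModuleSpace :=
  ModuleSpace.Pack R_Ring _ (ModuleSpace.Class _ _ _ Lop_ModuleSpace_mixin) (Lop E1 E2).

Definition opnorm L : R :=
  real (Lub_Rbar (fun r => exists x : E1, norm x <= 1 /\ r = norm (L x))).

Lemma opnorm_is_lub L :
  is_lub (fun r => exists x : E1, norm x <= 1 /\ r = norm (L x)) (opnorm L).
Proof.
unfold opnorm.
set (P := fun r => exists x : E1, norm x <= 1 /\ r = norm (L x)).
destruct (Lub_Rbar_correct P) as [Hub Hl].
destruct (linear_norm _ (Lop_linear L)) as [K [HK HLK]].
assert (P 0) as P0.
{ exists zero; split; [rewrite norm_zero; lra|].
  rewrite (linear_zero (L : E1 -> E2) (Lop_linear L)), norm_zero; reflexivity. }
assert (Rbar_le (Lub_Rbar P) K) as HbK.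
{ apply Hl; intros r [x [Hx ->]]; simpl.
  apply Rle_trans with (1 := HLK x).
  pose proof (Rmult_le_compat_l K _ _ (Rlt_le _ _ HK) Hx); lra. }
pose proof (Hub 0 P0) as H0.
destruct (Lub_Rbar P) as [l| |]; simpl in *; try tauto.
split.
- intros r Hr; exact (Hub r Hr).
- intros b Hb; apply (Hl (Finite b)); intros r Hr; exact (Hb r Hr).
Qed.

Lemma opnorm_ge_0 L : 0 <= opnorm L.
Proof.
destruct (opnorm_is_lub L) as [H _]; apply H.
exists zero; split; [rewrite norm_zero; lra|].
rewrite (linear_zero (L : E1 -> E2) (Lop_linear L)), norm_zero; reflexivity.
Qed.

Lemma opnorm_bound L x : norm (L x) <= opnorm L * norm x.
Proof.
destruct (Req_dec (norm x) 0) as [Hx|Hx].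
- rewrite (norm_eq_zero x Hx), (linear_zero (L : E1 -> E2) (Lop_linear L)), !norm_zero; lra.
- pose proof (norm_ge_0 x).
  destruct (opnorm_is_lub L) as [H' _].
  assert (0 < norm x) as Hx0 by lra.
  assert (0 < / norm x) as Hix by (apply Rinv_0_lt_compat; lra).
  assert (norm (L (scal (/ norm x) x)) <= opnorm L) as H1.
  { apply H'; exists (scal (/ norm x) x); split; [|reflexivity].
    rewrite norm_scal_R_eq, Rabs_pos_eq, Rinv_l by lra; lra. }
  rewrite (linear_scal _ (Lop_linear L)), norm_scal_R_eq, Rabs_pos_eq in H1 by lra.
  apply (Rmult_le_compat_l (norm x)) in H1; [|lra].
  rewrite <- Rmult_assoc, Rinv_r, Rmult_1_l in H1 by lra.
  lra.
Qed.

Lemma opnorm_le L K :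
  0 <= K -> (forall x, norm (L x) <= K * norm x) -> opnorm L <= K.
Proof.
intros HK H; destruct (opnorm_is_lub L) as [_ Hl]; apply Hl.
intros r [x [Hx ->]]; apply Rle_trans with (1 := H x).
pose proof (Rmult_le_compat_l K _ _ HK Hx); lra.
Qed.

Lemma opnorm_plus L M : opnorm (plus L M) <= opnorm L + opnorm M.
Proof.
apply opnorm_le.
- pose proof (opnorm_ge_0 L); pose proof (opnorm_ge_0 M); lra.
- intros x; change (plus L M x) with (plus (L x) (M x)).
  apply Rle_trans with (1 := norm_triangle _ _).
  pose proof (opnorm_bound L x); pose proof (opnorm_bound M x); lra.
Qed.

Lemma opnorm_scal (k : R) L : opnorm (scal k L) <= Rabs k * opnorm L.
Proof.
apply opnorm_le.
- apply Rmult_le_pos; [apply Rabs_pos|apply opnorm_ge_0].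
- intros x; change (scal k L x) with (scal k (L x)).
  rewrite norm_scal_R_eq, Rmult_assoc.
  apply Rmult_le_compat_l; [apply Rabs_pos|apply opnorm_bound].
Qed.

Lemma opnorm_eq_zero L : opnorm L = 0 -> L = zero.
Proof.
intros H; apply Lop_ext; intros x; apply norm_eq_zero.
pose proof (opnorm_bound L x); pose proof (norm_ge_0 (L x)).
rewrite H in *; lra.
Qed.

Definition Lop_ball L (e : R) M : Prop := opnorm (minus M L) < e.

Definition Lop_UniformSpace_mixin : UniformSpace.mixin_of (Lop E1 E2).
Proof.
refine (UniformSpace.Mixin _ Lop_zero Lop_ball _ _ _); unfold Lop_ball.
- intros L e; rewrite minus_eq_zero.
  apply Rle_lt_trans with 0; [|apply cond_pos].
  apply opnorm_le; [lra|]; intros x; change (norm (zero : E2) <= 0 * norm x).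
  rewrite norm_zero; lra.
- intros L M e H; apply Rle_lt_trans with (2 := H).
  replace (minus L M) with (scal (Ropp 1) (minus M L)).
  + apply Rle_trans with (1 := opnorm_scal _ _).
    rewrite Rabs_Ropp, Rabs_R1; lra.
  + rewrite <- (opp_minus M L); exact (scal_opp_one (minus M L)).
- intros L M N e1 e2 H1 H2; rewrite (minus_trans M N L).
  apply Rle_lt_trans with (1 := opnorm_plus _ _); lra.
Defined.
Canonical Lop_UniformSpace := UniformSpace.Pack _ Lop_UniformSpace_mixin (Lop E1 E2).

Canonical Lop_NormedModuleAux :=
  NormedModuleAux.Pack R_AbsRing (Lop E1 E2)
    (NormedModuleAux.Class R_AbsRing _ (ModuleSpace.class _ Lop_ModuleSpace)
       Lop_UniformSpace_mixin) (Lop E1 E2).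

Definition Lop_NormedModule_mixin : NormedModule.mixin_of R_AbsRing Lop_NormedModuleAux.
Proof.
refine (NormedModule.Mixin R_AbsRing _ opnorm 1 _ _ _ _ _).
- exact opnorm_plus.
- exact opnorm_scal.
- intros L M eps H; exact H.
- intros L M eps H; rewrite Rmult_1_l; exact H.
- exact opnorm_eq_zero.
Defined.
Canonical Lop_NormedModule :=
  NormedModule.Pack R_AbsRing (Lop E1 E2)
    (NormedModule.Class _ _ _ Lop_NormedModule_mixin) (Lop E1 E2).

End OperatorSpace.

Record HilbertSpace := mkHilbert
  { Hilbert_space :> CompleteNormedModule R_AbsRing;
    inner : Hilbert_space -> Hilbert_space -> R;
    inner_sym : forall x y, inner x y = inner y x;
    inner_plus_l : forall x y z, inner (plus x y) z = inner x z + inner y z;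
    inner_scal_l : forall (k : R) x y, inner (scal k x) y = k * inner x y;
    inner_norm : forall x, inner x x = norm x ^ 2 }.
Arguments inner {h} _ _.
Arguments inner_sym {h} _ _.
Arguments inner_plus_l {h} _ _ _.
Arguments inner_scal_l {h} _ _ _.
Arguments inner_norm {h} _.

Section Hilbert.
Context {X : HilbertSpace}.

Lemma inner_plus_r (x y z : X) : inner x (plus y z) = inner x y + inner x z.
Proof. rewrite inner_sym, inner_plus_l, !(inner_sym x); reflexivity. Qed.

Lemma inner_scal_r (k : R) (x y : X) : inner x (scal k y) = k * inner x y.
Proof. rewrite inner_sym, inner_scal_l, (inner_sym x); reflexivity. Qed.

Lemma opp_scal (x : X) : opp x = scal (Ropp 1) x.
Proof. symmetry; exact (scal_opp_one x). Qed.

Lemma inner_minus_l (x y z : X) : inner (minus x y) z = inner x z - inner y z.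
Proof.
change (inner (plus x (opp y)) z = inner x z - inner y z).
rewrite inner_plus_l, opp_scal, inner_scal_l; ring.
Qed.

Lemma inner_minus_r (x y z : X) : inner x (minus y z) = inner x y - inner x z.
Proof. rewrite inner_sym, inner_minus_l, !(inner_sym x); reflexivity. Qed.

Lemma inner_zero_r (x y : X) : norm y = 0 -> inner x y = 0.
Proof.
intros Hy.
assert (y = scal 0 y) as ->; [|rewrite inner_scal_r; ring].
transitivity (zero : X); [exact (norm_eq_zero y Hy)|].
symmetry; exact (scal_zero_l y).
Qed.

Lemma norm2_plus (x y : X) : norm (plus x y) ^ 2 = norm x ^ 2 + 2 * inner x y + norm y ^ 2.
Proof.
rewrite <- inner_norm.
change (inner (plus x y) (plus x y) = norm x ^ 2 + 2 * inner x y + norm y ^ 2).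
rewrite inner_plus_l, !inner_plus_r, (inner_sym y x), !inner_norm; ring.
Qed.

Lemma norm2_minus (x y : X) : norm (minus x y) ^ 2 = norm x ^ 2 - 2 * inner x y + norm y ^ 2.
Proof.
rewrite <- inner_norm, inner_minus_l, !inner_minus_r, (inner_sym y x), !inner_norm; ring.
Qed.

Lemma norm2_scal (k : R) (x : X) : norm (scal k x) ^ 2 = k ^ 2 * norm x ^ 2.
Proof.
assert (norm (scal k x) = Rabs k * norm x) as H by exact (norm_scal_R_eq k x).
rewrite H, Rpow_mult_distr, pow2_abs; reflexivity.
Qed.

Lemma cauchy_schwarz (x y : X) : Rabs (inner x y) <= norm x * norm y.
Proof.
pose proof (norm_ge_0 x) as Hx; pose proof (norm_ge_0 y) as Hy.
assert (forall a b : R, 0 <= a ^ 2 * norm x ^ 2 + 2 * a * b * inner x y + b ^ 2 * norm y ^ 2)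
  as H.
{ intros a b.
  pose proof (pow2_ge_0 (norm (plus (scal a x) (scal b y)))) as H.
  rewrite norm2_plus, !norm2_scal, inner_scal_l, inner_scal_r in H.
  lra. }
apply Rsqr_incr_0_var; [|apply Rmult_le_pos; assumption].
rewrite <- Rsqr_abs; unfold Rsqr.
destruct (Req_dec (norm y) 0) as [Hy0|Hy0].
- rewrite (inner_zero_r x y Hy0), Hy0; lra.
- specialize (H (norm y ^ 2) (- inner x y)).
  assert (0 < norm y ^ 2) by (apply pow_lt; lra).
  nra.
Qed.

(* Riesz representation: the representative maximizes [phi x - |x|^2 / 2]. *)
Theorem riesz (phi : X -> R_NormedModule) :
  is_linear phi -> exists a : X, forall v, phi v = inner a v.
Proof.
intros Hphi.
pose (J := fun x : X => phi x - norm x ^ 2 / 2).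
destruct (linear_norm _ Hphi) as [K [HK HphiK]].
assert (forall x, J x <= K ^ 2 / 2) as HJK.
{ intros x; unfold J.
  pose proof (HphiK x) as H; change (norm (phi x)) with (Rabs (phi x)) in H.
  pose proof (Rle_abs (phi x)) as H'.
  pose proof (pow2_ge_0 (K - norm x)) as H2.
  lra. }
assert (exists s, is_lub (fun r => exists x, r = J x) s) as [s Hs].
{ destruct (completeness (fun r => exists x, r = J x)) as [s Hs].
  - exists (K ^ 2 / 2); intros r [x ->]; apply HJK.
  - exists (J zero), zero; reflexivity.
  - exists s; exact Hs. }
assert (forall x, J x <= s) as Hsup by (intros x; apply Hs; exists x; reflexivity).
assert (forall e, 0 < e -> exists x, s - e < J x) as Happ.
{ intros e He; apply Classical_Prop.NNPP; intros Hn.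
  assert (s <= s - e); [|lra].
  apply Hs; intros r [x ->]; apply Rnot_lt_le; intros H; apply Hn; exists x; exact H. }
assert (forall x y e, s - e < J x -> s - e < J y -> norm (minus x y) ^ 2 <= 8 * e) as Hcau.
{ intros x y e Hx Hy.
  pose proof (Hsup (scal (/ 2) (plus x y))) as H; unfold J in *.
  rewrite (linear_scal _ Hphi), (linear_plus _ Hphi) in H.
  change (/ 2 * (phi x + phi y) - norm (scal (/ 2) (plus x y)) ^ 2 / 2 <= s) in H.
  rewrite norm2_scal, norm2_plus in H.
  rewrite norm2_minus.
  lra. }
pose (F := fun P : X -> Prop => exists e, 0 < e /\ forall x, s - e < J x -> P x).
assert (ProperFilter F) as PF.
{ constructor.
  - intros P [e [He HP]]; destruct (Happ e He) as [x Hx]; exists x; apply HP, Hx.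
  - constructor.
    + exists 1; split; [lra|trivial].
    + intros P Q [e [He HP]] [d [Hd HQ]].
      pose proof (Rmin_l e d); pose proof (Rmin_r e d).
      exists (Rmin e d); split; [apply Rmin_pos; assumption|].
      intros x Hx; split; [apply HP|apply HQ]; lra.
    + intros P Q HPQ [e [He HP]]; exists e; split; [exact He|auto]. }
assert (cauchy F) as CF.
{ intros eps.
  pose proof (cond_pos eps) as Heps.
  set (e := eps ^ 2 / 16).
  assert (0 < e) as He by (unfold e; nra).
  destruct (Happ e He) as [x Hx].
  exists x, e; split; [exact He|].
  intros y Hy; apply (norm_compat1 x y eps).
  pose proof (Hcau y x e Hy Hx) as H; unfold e in H.
  assert (0 <= norm (minus y x)) as H0 by apply norm_ge_0.
  assert (norm (minus y x) < eps) by nra.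
  assumption. }
exists (lim F); intros v.
set (a := lim F).
set (c := @norm_factor R_AbsRing X).
assert (0 < c) as Hc by apply norm_factor_gt_0.
pose proof (norm_ge_0 v) as Hv.
destruct (Req_dec (phi v) (inner a v)) as [|Hne]; [assumption|exfalso].
assert (0 < Rabs (phi v - inner a v)) as Hd by (apply Rabs_pos_lt; lra).
set (d := Rabs (phi v - inner a v)) in *.
assert (forall e : posreal, d <= sqrt (2 * e) * norm v + c * e * norm v) as Hall.
{ intros e.
  destruct (complete_cauchy F PF CF e) as [e' [He' Hball]].
  pose proof (Rmin_l e e') as Hm1; pose proof (Rmin_r e e') as Hm2.
  pose proof (cond_pos e) as Hepos.
  destruct (Happ (Rmin e e')) as [x Hx]; [apply Rmin_pos; assumption|].
  assert (norm (minus x a) < c * e) as Hxa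
    by (apply (norm_compat2 a x e), Hball; lra).
  assert (Rabs (phi v - inner x v) <= sqrt (2 * e) * norm v) as H1.
  { set (q := phi v - inner x v).
    assert (forall t, t * q - t ^ 2 * norm v ^ 2 / 2 <= e) as Ht.
    { intros t; pose proof (Hsup (plus x (scal t v))) as H; unfold J in *.
      rewrite (linear_plus _ Hphi), (linear_scal _ Hphi) in H.
      change (phi x + t * phi v - norm (plus x (scal t v)) ^ 2 / 2 <= s) in H.
      rewrite norm2_plus, norm2_scal, inner_scal_r in H.
      unfold q; lra. }
    apply Rsqr_incr_0_var; [|apply Rmult_le_pos; [apply sqrt_pos|exact Hv]].
    rewrite <- Rsqr_abs, Rsqr_mult, Rsqr_sqrt by lra; unfold Rsqr.
    destruct (Req_dec (norm v) 0) as [Hv0|Hv0].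
    - assert (q = 0) as ->; [|rewrite Hv0; lra].
      unfold q; rewrite (inner_zero_r x v Hv0).
      pose proof (HphiK v) as H0; rewrite Hv0 in H0.
      change (Rabs (phi v) <= K * 0) in H0.
      pose proof (Rle_abs (phi v)); pose proof (Rle_abs (- phi v)) as H1.
      rewrite Rabs_Ropp in H1; lra.
    - assert (0 < norm v ^ 2) as Hv2 by (apply pow_lt; lra).
      specialize (Ht (q / norm v ^ 2)).
      replace (q / norm v ^ 2 * q - (q / norm v ^ 2) ^ 2 * norm v ^ 2 / 2)
        with (q * q / 2 / norm v ^ 2) in Ht by (field; exact Hv0).
      apply (Rmult_le_compat_r (norm v ^ 2)) in Ht; [|lra].
      unfold Rdiv in Ht; rewrite Rmult_assoc, Rinv_l in Ht by lra.
      lra. }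
  pose proof (cauchy_schwarz (minus x a) v) as H2.
  rewrite inner_minus_l in H2.
  unfold d; replace (phi v - inner a v)
    with ((phi v - inner x v) + (inner x v - inner a v)) by ring.
  apply Rle_trans with (1 := Rabs_triang _ _).
  pose proof (Rmult_le_compat_r (norm v) _ _ Hv (Rlt_le _ _ Hxa)).
  lra. }
set (r := Rmin 1 (d / (2 * (1 + c) * (1 + norm v)))).
assert (0 < 2 * (1 + c) * (1 + norm v)) as Hden by nra.
assert (0 < r) as Hr
  by (apply Rmin_pos; [lra|apply Rdiv_lt_0_compat; assumption]).
assert (r <= 1) as Hr1 by apply Rmin_l.
assert (r * (2 * (1 + c) * (1 + norm v)) <= d) as Hrd.
{ apply Rle_trans with (d / (2 * (1 + c) * (1 + norm v)) * (2 * (1 + c) * (1 + norm v))).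
  - apply Rmult_le_compat_r; [lra|apply Rmin_r].
  - right; field; split; lra. }
assert (0 < r ^ 2 / 2) as He by nra.
pose proof (Hall (mkposreal _ He)) as H.
change (pos (mkposreal _ He)) with (r ^ 2 / 2) in H.
replace (2 * (r ^ 2 / 2)) with (r ^ 2) in H by field.
rewrite (sqrt_pow2 r) in H by lra.
assert (r ^ 2 / 2 <= r) by nra.
assert (c * (r ^ 2 / 2) * norm v <= c * r * norm v)
  by (apply Rmult_le_compat_r; [lra|apply Rmult_le_compat_l; lra]).
assert (0 <= r * norm v) by nra.
assert (0 <= r * c) by nra.
assert (0 <= r * c * norm v) by nra.
lra.
Qed.

Lemma inner_eq (x y : X) : (forall v, inner x v = inner y v) -> x = y.
Proof.
intros H.
assert (minus x y = (zero : X)) as Hm.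
{ apply (norm_eq_zero (minus x y : X)).
  assert (norm (minus x y : X) ^ 2 = 0) as H0
    by (rewrite <- inner_norm, inner_minus_l, H; ring).
  assert (0 <= norm (minus x y : X)) by apply norm_ge_0.
  assert (norm (minus x y : X) = 0) by nra.
  assumption. }
apply (plus_reg_r (opp y)); rewrite plus_opp_r; exact Hm.
Qed.

End Hilbert.

Lemma adjoint_exists {X Y : HilbertSpace} (L : Lop X Y) :
  exists M : Lop Y X, forall x y, inner (L x) y = inner x (M y).
Proof.
assert (forall y, exists a : X, forall v, inner (L v) y = inner v a) as H.
{ intros y.
  destruct (riesz (fun v => inner (L v) y : R_NormedModule)) as [a Ha].
  - constructor.
    + intros u v; rewrite (linear_plus _ (Lop_linear L)); apply inner_plus_l.
    + intros k v; rewrite (linear_scal _ (Lop_linear L)); apply inner_scal_l.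
    + exists (opnorm L * norm y + 1); split.
      * pose proof (opnorm_ge_0 L); pose proof (norm_ge_0 y); nra.
      * intros v; change (Rabs (inner (L v) y) <= (opnorm L * norm y + 1) * norm v).
        apply Rle_trans with (1 := cauchy_schwarz _ _).
        pose proof (opnorm_bound L v); pose proof (norm_ge_0 v); pose proof (norm_ge_0 y).
        nra.
  - exists a; intros v; rewrite (inner_sym v a); apply Ha. }
pose (m := fun y => proj1_sig (constructive_indefinite_description _ (H y))).
assert (forall x y, inner (L x) y = inner x (m y)) as Hm
  by (intros x y; exact (proj2_sig (constructive_indefinite_description _ (H y)) x)).
assert (is_linear (m : Y -> X)) as Hl.
{ constructor.
  - intros y z; apply inner_eq; intros v.
    transitivity (inner (m y) v + inner (m z) v); [|symmetry; apply inner_plus_l].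
    rewrite !(inner_sym _ v), <- !Hm; apply inner_plus_r.
  - intros k y; apply inner_eq; intros v.
    transitivity (k * inner (m y) v); [|symmetry; apply inner_scal_l].
    rewrite !(inner_sym _ v), <- !Hm; apply inner_scal_r.
  - exists (opnorm L + 1); split; [pose proof (opnorm_ge_0 L); lra|].
    intros y.
    pose proof (Hm (m y) y) as H1; rewrite inner_norm in H1.
    pose proof (Rle_abs (inner (L (m y)) y)) as H2.
    pose proof (cauchy_schwarz (L (m y)) y) as H3.
    pose proof (opnorm_bound L (m y)) as H4.
    pose proof (norm_ge_0 y); pose proof (norm_ge_0 (m y)); pose proof (opnorm_ge_0 L).
    assert (norm (m y) ^ 2 <= opnorm L * norm (m y) * norm y) as Hmy
      by (pose proof (Rmult_le_compat_r (norm y) _ _ ltac:(assumption) H4); lra).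
    destruct (Req_dec (norm (m y)) 0) as [Hm0|Hm0]; [rewrite Hm0; nra|].
    assert (norm (m y) <= opnorm L * norm y)
      by (apply (Rmult_le_reg_l (norm (m y))); lra).
    lra. }
exists (mkLop m Hl); exact Hm.
Qed.

Definition adjoint {X Y : HilbertSpace} (L : Lop X Y) : Lop Y X :=
  proj1_sig (constructive_indefinite_description _ (adjoint_exists L)).

Lemma adjointP {X Y : HilbertSpace} (L : Lop X Y) x y :
  inner (L x) y = inner x (adjoint L y).
Proof.
exact (proj2_sig (constructive_indefinite_description _ (adjoint_exists L)) x y).
Qed.

Definition bounded_set {E : NormedModule R_AbsRing} (B : E -> Prop) : Prop :=
  exists r : R, forall x, B x -> norm x <= r.

Definition locally_lipschitz {E1 E2 : NormedModule R_AbsRing} (f : E1 -> E2) : Prop :=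
  forall B : E1 -> Prop, bounded_set B ->
  exists k : R, forall x y, B x -> B y -> norm (minus (f x) (f y)) <= k * norm (minus x y).

(* [f] is of class C^1 with Frechet differential [df]; continuity of [df] is
   with respect to the operator norm. *)
Definition is_C1 {E1 E2 : NormedModule R_AbsRing} (f : E1 -> E2) (df : E1 -> Lop E1 E2) : Prop :=
  (forall x, filterdiff f (locally x) (df x)) /\ (forall x, continuous df x).

(* Only the values [T t] with [0 <= t] are meaningful. *)
Definition C0_semigroup {E : NormedModule R_AbsRing} (T : R -> Lop E E) : Prop :=
  (forall x, T 0 x = x) /\
  (forall s t x, 0 <= s -> 0 <= t -> T (s + t) x = T s (T t x)) /\
  (forall x, filterlim (fun t => T t x) (at_right 0) (locally x)).

(* An unbounded operator is given by its domain [D] and a total function [A]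
   whose values outside [D] are irrelevant. *)
Definition infinitesimal_generator {E : NormedModule R_AbsRing}
  (T : R -> Lop E E) (D : E -> Prop) (A : E -> E) : Prop :=
  let quotient x t := scal (/ t) (minus (T t x) x) in
  (forall x, D x <-> exists y, filterlim (quotient x) (at_right 0) (locally y)) /\
  (forall x, D x -> filterlim (quotient x) (at_right 0) (locally (A x))).

Definition C0_generator {E : NormedModule R_AbsRing} (D : E -> Prop) (A : E -> E) : Prop :=
  exists T, C0_semigroup T /\ infinitesimal_generator T D A.

(* [C] restricted to [D] belongs to L(D(A), Y), where D(A) carries the graph norm. *)
Definition graph_bounded_linear {E1 E2 : NormedModule R_AbsRing}
  (D : E1 -> Prop) (A : E1 -> E1) (C : E1 -> E2) : Prop :=
  (forall x y, D x -> D y -> C (plus x y) = plus (C x) (C y)) /\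
  (forall (k : R) x, D x -> C (scal k x) = scal k (C x)) /\
  (exists c : R, forall x, D x -> norm (C x) <= c * (norm x + norm (A x))).

(* Global mild solutions on [0, +oo) of w' = A w + F(w); [T] is the semigroup
   generated by A, which is unique. *)
Definition mild_solution {E : NormedModule R_AbsRing}
  (D : E -> Prop) (A : E -> E) (F : E -> E) (w : R -> E) : Prop :=
  continuous_on (fun t => 0 <= t) w /\
  exists T, C0_semigroup T /\ infinitesimal_generator T D A /\
    forall t, 0 <= t ->
      is_RInt (fun s => T (t - s) (F (w s))) 0 t (minus (w t) (T t (w 0))).

Definition zero_locally_exponentially_stable {E : NormedModule R_AbsRing}
  (solution : (R -> E) -> Prop) : Prop :=
  exists delta K omega : R, 0 < delta /\ 0 < K /\ 0 < omega /\
    forall w, solution w -> norm (w 0) < delta ->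
    forall t, 0 <= t -> norm (w t) <= K * exp (- omega * t) * norm (w 0).

Definition quadratic_like {X : NormedModule R_AbsRing} (V : X -> R) : Prop :=
  exists m1 m2 : R, 0 < m1 /\ 0 < m2 /\
    forall x, m1 * norm x ^ 2 <= V x /\ V x <= m2 * norm x ^ 2.

Definition semiglobal_ISS {X U : NormedModule R_AbsRing}
  (D : X -> Prop) (A f : X -> X) (g : X -> Lop U X) : Prop :=
  (exists (V : X -> R_NormedModule) (dV : X -> Lop X R_NormedModule) (beta : R),
     is_C1 V dV /\ quadratic_like V /\ 0 < beta /\
     forall x u, D x ->
       dV x (plus (plus (A x) (f x)) (g x u)) <= beta * norm u ^ 2) /\
  (forall B : X -> Prop, bounded_set B -> open B ->
   exists (V : X -> R_NormedModule) (dV : X -> Lop X R_NormedModule) (alpha beta : R),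
     is_C1 V dV /\ quadratic_like V /\ 0 < alpha /\ 0 < beta /\
     forall x u, D x -> B x ->
       dV x (plus (plus (A x) (f x)) (g x u)) <= - alpha * V x + beta * norm u ^ 2).

Definition invariant_graph {X Y : NormedModule R_AbsRing}
  (D : X -> Prop) (A f : X -> X) (C h : X -> Y) (S : Lop Y Y)
  (M : X -> Y) (dM : X -> Lop X Y) : Prop :=
  is_C1 M dM /\ locally_lipschitz dM /\ M zero = zero /\
  forall x, D x -> dM x (plus (A x) (f x)) = plus (plus (S (M x)) (C x)) (h x).

Definition feedback {X U Y : HilbertSpace}
  (g : X -> Lop U X) (M : X -> Y) (dM : X -> Lop X Y) (x : X) (z : Y) : U :=
  adjoint (g x) (adjoint (dM x) (minus z (M x))).

(* The closed loop is the perturbation by [closed_loop_nonlinearity] of the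
   semigroup generated by [x, z] |-> [A x, C x] with domain D(A) * Y. The norm of
   the product space is the Hilbertian one, sqrt (|x|^2 + |z|^2). *)
Definition closed_loop_nonlinearity {X U Y : HilbertSpace}
  (f : X -> X) (g : X -> Lop U X) (h : X -> Y) (S : Lop Y Y)
  (M : X -> Y) (dM : X -> Lop X Y) (w : X * Y) : X * Y :=
  let (x, z) := w in
  (plus (f x) (g x (feedback g M dM x z)), plus (S z) (h x)).

Definition closed_loop_solution {X U Y : HilbertSpace}
  (D : X -> Prop) (A f : X -> X) (g : X -> Lop U X) (C h : X -> Y) (S : Lop Y Y)
  (M : X -> Y) (dM : X -> Lop X Y) (w : R -> X * Y) : Prop :=
  mild_solution (fun p : X * Y => D (fst p)) (fun p : X * Y => (A (fst p), C (fst p)))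
    (closed_loop_nonlinearity f g h S M dM) w.

(* Main.v *)
Require Import Defs.
From Stdlib Require Import Reals Lra Psatz List ClassicalEpsilon.
From Coquelicot Require Import Coquelicot.
Open Scope R_scope.

(** The invariant graph turns the closed loop into a cascade.  With [e = z - M x] the open
    loop terms cancel and [e' = S e - dM(x) g(x) u], so that the feedback
    [u = (dM(x) g(x))^* e] and the skew-adjointness of [S] give
    [(|e|^2)' = - 2 |u|^2] ([graph_error_dissipation]).  If [V] is an ISS functional on the
    unit ball with gain [beta], then [W = V(x) + beta |e|^2] satisfies
    [W' <= - alpha V(x) - beta |u|^2].  Since [dM(0) g(0)] is onto, its adjoint is bounded
    below ([adjoint_bounded_below]), and by continuity [|u| >= c |e|] for small [x]
    ([feedback_coercive_near_0]).  Hence [W' <= - omega W] near the origin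
    ([closed_loop_dissipation]).  As [W] is locally equivalent to the square of the norm
    ([graph_lyapunov_equivalent]), small sublevel sets of [W] trap the trajectories, which
    decay exponentially ([exponential_decay_in_sublevel]).

    The analytic difficulty is that a mild solution need not be differentiable, whereas
    the inequality for [W'] only makes sense on the domain of the generator.  No regularity
    theory is used to overcome it.  Upper right Dini derivatives are enough to integrate
    differential inequalities ([dini_growth]).  At a point [p0] of a mild solution,
    the solution agrees, up to an arbitrarily small multiple of the elapsed time [s],
    with the affine path [T s p0 + s c], where [c] is in the domain and close enough to the
    nonlinearity [F p0] ([dini_along_mild]); such
    a path is a limit of paths [T s p + s c] with [p] in the domain, which remain in the
    domain and have right derivatives ([affine_path_right_derivative]).  The rate of decay
    is thus transported to mild solutions at each time separately.

    The estimates need the local boundedness of a strongly continuous semigroup and the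
    density of the domain of its generator.  The first, like the lower bound on the
    adjoint, comes from the uniform boundedness principle. *)

(** * Linear identities in normed modules *)

(** Syntax of linear combinations of atoms, which refer to the entries of a list.  An
    identity between two of them follows from the equality of the coefficients of
    each atom; this is what the tactic [vec] relies on. *)
Inductive vexpr :=
| VZero | VAtom (n : nat) | VPlus (a b : vexpr) | VOpp (a : vexpr)
| VScal (k : R) (a : vexpr).

Fixpoint vcoef (e : vexpr) (n : nat) : R :=
  match e with
  | VZero => 0
  | VAtom m => if Nat.eqb n m then 1 else 0
  | VPlus a b => vcoef a n + vcoef b n
  | VOpp a => - vcoef a n
  | VScal k a => k * vcoef a n
  end.

Section Vexpr.
Context {E : NormedModule R_AbsRing}.

Fixpoint veval (l : list E) (e : vexpr) : E :=
  match e with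
  | VZero => zero
  | VAtom n => nth n l zero
  | VPlus a b => plus (veval l a) (veval l b)
  | VOpp a => opp (veval l a)
  | VScal k a => scal k (veval l a)
  end.

Fixpoint lincomb (c : nat -> R) (l : list E) : E :=
  match l with
  | nil => zero
  | x :: l' => plus (scal (c O) x) (lincomb (fun n => c (S n)) l')
  end.

Fixpoint same_coefs (c d : nat -> R) (l : list E) : Prop :=
  match l with
  | nil => True
  | _ :: l' => c O = d O /\ same_coefs (fun n => c (S n)) (fun n => d (S n)) l'
  end.

Lemma lincomb_ext c d l : same_coefs c d l -> lincomb c l = lincomb d l.
Proof.
revert c d; induction l as [|x l IH]; intros c d; simpl; [reflexivity|].
intros [-> H]; rewrite (IH _ _ H); reflexivity.
Qed.

Lemma lincomb_zero l : lincomb (fun _ => 0) l = zero.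
Proof.
induction l as [|x l IH]; simpl; [reflexivity|].
rewrite IH, plus_zero_r; exact (scal_zero_l x).
Qed.

Lemma lincomb_plus c d l :
  lincomb (fun n => c n + d n) l = plus (lincomb c l) (lincomb d l).
Proof.
revert c d; induction l as [|x l IH]; intros c d; simpl; [symmetry; apply plus_zero_l|].
rewrite (IH (fun n => c (S n)) (fun n => d (S n))).
replace (scal (c O + d O) x) with (plus (scal (c O) x) (scal (d O) x))
  by (symmetry; exact (scal_distr_r (c O : R_AbsRing) (d O) x)).
rewrite <- !plus_assoc; f_equal; rewrite !plus_assoc; f_equal; apply plus_comm.
Qed.

Lemma lincomb_scal k c l : lincomb (fun n => k * c n) l = scal k (lincomb c l).
Proof.
revert c; induction l as [|x l IH]; intros c; simpl; [symmetry; exact (scal_zero_r _)|].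
rewrite (IH (fun n => c (S n))).
transitivity (plus (scal k (scal (c O) x)) (scal k (lincomb (fun n => c (S n)) l))).
- f_equal; symmetry; exact (scal_assoc (k : R_AbsRing) (c O) x).
- symmetry; exact (scal_distr_l (k : R_AbsRing) _ _).
Qed.

Lemma veval_lincomb l e : veval l e = lincomb (vcoef e) l.
Proof.
induction e as [|n|a IHa b IHb|a IHa|k a IHa]; simpl.
- symmetry; apply lincomb_zero.
- revert n; induction l as [|x l IH]; intros [|n]; simpl; try reflexivity.
  + rewrite (lincomb_zero l), plus_zero_r; symmetry; exact (scal_one x).
  + rewrite (IH n).
    transitivity (plus zero (lincomb (vcoef (VAtom n)) l)); [symmetry; apply plus_zero_l|].
    f_equal; symmetry; exact (scal_zero_l x).
- rewrite IHa, IHb; symmetry; apply lincomb_plus.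
- rewrite IHa.
  transitivity (scal (Ropp 1) (lincomb (vcoef a) l)); [symmetry; exact (scal_opp_one _)|].
  rewrite <- lincomb_scal; apply lincomb_ext.
  generalize (vcoef a); clear; induction l as [|x l IH]; intros c; simpl; [exact I|].
  split; [ring|apply (IH (fun n => c (S n)))].
- rewrite IHa; symmetry; apply lincomb_scal.
Qed.

Lemma veval_eq l e1 e2 :
  same_coefs (vcoef e1) (vcoef e2) l -> veval l e1 = veval l e2.
Proof. rewrite !veval_lincomb; apply lincomb_ext. Qed.

End Vexpr.

Ltac vec_index x l :=
  lazymatch l with
  | x :: _ => constr:(O)
  | _ :: ?l' => let n := vec_index x l' in constr:(S n)
  end.

Ltac vec_mem x l :=
  lazymatch l with
  | nil => constr:(false)
  | x :: _ => constr:(true)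
  | _ :: ?l' => vec_mem x l'
  end.

Ltac vec_atoms e l :=
  lazymatch e with
  | plus ?a ?b => let l1 := vec_atoms a l in vec_atoms b l1
  | minus ?a ?b => let l1 := vec_atoms a l in vec_atoms b l1
  | opp ?a => vec_atoms a l
  | scal _ ?a => vec_atoms a l
  | zero => l
  | _ => lazymatch vec_mem e l with true => l | false => constr:(e :: l) end
  end.

Ltac vec_reify e l :=
  lazymatch e with
  | plus ?a ?b => let u := vec_reify a l in let v := vec_reify b l in constr:(VPlus u v)
  | minus ?a ?b =>
      let u := vec_reify a l in let v := vec_reify b l in constr:(VPlus u (VOpp v))
  | opp ?a => let u := vec_reify a l in constr:(VOpp u)
  | scal ?k ?a => let u := vec_reify a l in constr:(VScal k u)
  | zero => constr:(VZero)
  | _ => let n := vec_index e l in constr:(VAtom n)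
  end.

Ltac vec E :=
  lazymatch goal with
  | |- ?a = ?b =>
      let l0 := constr:(@nil (NormedModule.sort R_AbsRing E)) in
      let l1 := vec_atoms a l0 in
      let l := vec_atoms b l1 in
      let u := vec_reify a l in
      let v := vec_reify b l in
      change (@veval E l u = @veval E l v);
      apply veval_eq; cbn [same_coefs vcoef Nat.eqb]; repeat split; try ring; try field
  end.

(** The term under the norm is taken from the goal: a copy of it, elaborated anew, may go
    through other structure projections and fail to match. *)
Ltac norm_as E y :=
  lazymatch goal with
  | |- norm ?z <= _ => replace z with y; [|symmetry; vec E]
  | |- norm ?z < _ => replace z with y; [|symmetry; vec E]
  end.

Section Norms.
Context {E : NormedModule R_AbsRing}.
Implicit Types x y z : E.

Lemma norm_minus_sym x y : norm (minus x y) = norm (minus y x).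
Proof. rewrite <- (norm_opp (minus x y)); f_equal; vec E. Qed.

Lemma norm_minus_triangle x y z : norm (minus x z) <= norm (minus x y) + norm (minus y z).
Proof.
replace (minus x z) with (plus (minus x y) (minus y z)) by (vec E).
apply norm_triangle.
Qed.

Lemma norm_plus_bound x y a b :
  norm x <= a -> norm y <= b -> norm (plus x y) <= a + b.
Proof. intros Hx Hy; apply Rle_trans with (1 := norm_triangle x y); lra. Qed.

Lemma norm_minus_le x y : norm (minus x y) <= norm x + norm y.
Proof.
apply Rle_trans with (1 := norm_triangle x (opp y)); rewrite norm_opp; lra.
Qed.

Lemma norm_le_minus x y : norm x <= norm y + norm (minus x y).
Proof.
replace x with (plus y (minus x y)) at 1 by (vec E); apply norm_triangle.
Qed.

Lemma norm_scal_le (k : R) x : norm (scal k x) <= Rabs k * norm x.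
Proof. exact (norm_scal k x). Qed.

Lemma norm_minus_diag x : norm (minus x x) = 0.
Proof. rewrite minus_eq_zero; apply norm_zero. Qed.

End Norms.

(** * Limits in terms of norms *)

Section EpsilonDelta.
Context {E1 E2 : NormedModule R_AbsRing}.

Lemma locally_norm_iff {E : NormedModule R_AbsRing} (x : E) (P : E -> Prop) :
  locally x P <-> exists eta, 0 < eta /\ forall y, norm (minus y x) < eta -> P y.
Proof.
split.
- intros H; apply (locally_norm_le_locally x) in H; destruct H as [eta H].
  exists eta; split; [apply cond_pos|exact H].
- intros [eta [Heta H]]; apply (locally_le_locally_norm x P).
  exists (mkposreal eta Heta); exact H.
Qed.

Lemma filterlim_norm_iff {T : Type} (F : (T -> Prop) -> Prop) {FF : Filter F}
  (f : T -> E2) (y : E2) :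
  filterlim f F (locally y) <->
  forall eps, 0 < eps -> F (fun t => norm (minus (f t) y) < eps).
Proof.
rewrite filterlim_locally_ball_norm; split.
- intros H eps Heps; exact (H (mkposreal eps Heps)).
- intros H eps; exact (H eps (cond_pos eps)).
Qed.

Lemma continuous_norm_iff (f : E1 -> E2) (x : E1) :
  continuous f x <-> forall eps, 0 < eps -> exists eta, 0 < eta /\
    forall y, norm (minus y x) < eta -> norm (minus (f y) (f x)) < eps.
Proof.
unfold continuous; rewrite (filterlim_norm_iff (locally x)).
split; intros H eps Heps; apply locally_norm_iff; exact (H eps Heps).
Qed.

Lemma filterlim_at_right_0_iff (f : R -> E2) (y : E2) :
  filterlim f (at_right 0) (locally y) <->
  forall eps, 0 < eps -> exists eta, 0 < eta /\
    forall t, 0 < t < eta -> norm (minus (f t) y) < eps.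
Proof.
rewrite (filterlim_norm_iff (at_right 0)); split; intros H eps Heps.
- destruct (H eps Heps) as [eta Heta]; exists eta; split; [apply cond_pos|].
  intros t Ht; apply Heta; [|lra].
  change (Rabs (t - 0) < eta); rewrite Rabs_pos_eq; lra.
- destruct (H eps Heps) as [eta [Heta H']]; exists (mkposreal eta Heta).
  intros t Ht Ht0; apply H'; split; [exact Ht0|].
  change (Rabs (t - 0) < eta) in Ht; rewrite Rabs_pos_eq in Ht; lra.
Qed.

Lemma continuous_on_nonneg_iff (w : R -> E2) :
  continuous_on (fun t => 0 <= t) w <->
  forall t, 0 <= t -> forall eps, 0 < eps -> exists eta, 0 < eta /\
    forall s, 0 <= s -> Rabs (s - t) < eta -> norm (minus (w s) (w t)) < eps.
Proof.
assert (forall t : R, Filter (within (fun s : R => 0 <= s) (locally t))) as FF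
  by (intros t; apply within_filter, locally_filter).
unfold continuous_on; split; intros H t Ht.
- pose proof (proj1 (filterlim_norm_iff _ w (w t)) (H t Ht)) as H'; intros eps Heps.
  destruct (H' eps Heps) as [eta Heta]; exists eta; split; [apply cond_pos|].
  intros s Hs Hst; apply Heta; assumption.
- apply (filterlim_norm_iff (within (fun s : R => 0 <= s) (locally t))).
  intros eps Heps.
  destruct (H t Ht eps Heps) as [eta [Heta H']]; exists (mkposreal eta Heta).
  intros s Hst Hs; apply H'; assumption.
Qed.

Lemma filterdiff_norm (f : E1 -> E2) (x : E1) (l : E1 -> E2) :
  filterdiff f (locally x) l ->
  forall eps, 0 < eps -> exists eta, 0 < eta /\ forall y, norm (minus y x) < eta ->
    norm (minus (minus (f y) (f x)) (l (minus y x))) <= eps * norm (minus y x).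
Proof.
intros [_ H] eps Heps.
apply locally_norm_iff; exact (H x (fun P HP => HP) (mkposreal eps Heps)).
Qed.

Lemma locally_lipschitz_continuous (f : E1 -> E2) (x : E1) :
  locally_lipschitz f -> continuous f x.
Proof.
intros H; apply continuous_norm_iff; intros eps Heps.
destruct (H (fun y => norm (minus y x) <= 1)) as [k Hk].
{ exists (norm x + 1); intros y Hy; pose proof (norm_le_minus y x); lra. }
pose proof (Rabs_pos k) as Hk0; pose proof (Rle_abs k) as Hk1.
exists (Rmin 1 (eps / (1 + Rabs k))); split.
- apply Rmin_pos; [lra|apply Rdiv_lt_0_compat; lra].
- intros y Hy; pose proof (norm_ge_0 (minus y x)) as Hn.
  pose proof (Rmin_l 1 (eps / (1 + Rabs k))); pose proof (Rmin_r 1 (eps / (1 + Rabs k))).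
  apply Rle_lt_trans with (1 := Hk y x ltac:(lra) ltac:(rewrite norm_minus_diag; lra)).
  assert (norm (minus y x) * (1 + Rabs k) < eps).
  { replace eps with (eps / (1 + Rabs k) * (1 + Rabs k)) by (field; lra).
    apply Rmult_lt_compat_r; lra. }
  nra.
Qed.

End EpsilonDelta.

(** * Upper right Dini derivatives *)

Definition dini_le (phi : R -> R) (t c : R) : Prop :=
  forall eps, 0 < eps -> exists eta, 0 < eta /\
    forall k, 0 <= k <= eta -> phi (t + k) <= phi t + k * (c + eps).

(** The bound on the derivative is only asked below a line of slope larger than [c];
    this lets a Lyapunov estimate which is only valid in a sublevel set confine the
    trajectory to it.  The set of times up to which [phi] stays below the line
    of slope [c + e] is closed because [phi] does not jump upwards, and open on the
    right by the Dini bound. *)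
Lemma dini_growth (phi : R -> R) (a b c e0 : R) :
  a <= b -> 0 < e0 ->
  (forall t, a < t <= b -> forall eps, 0 < eps -> exists eta, 0 < eta /\
     forall s, a <= s <= t -> t - eta < s -> phi t <= phi s + eps) ->
  (forall t, a <= t < b -> phi t <= phi a + (c + e0) * (t - a) -> dini_le phi t c) ->
  phi b <= phi a + c * (b - a).
Proof.
intros Hab He0 Hjump Hdini.
assert (forall e, 0 < e <= e0 -> phi b <= phi a + (c + e) * (b - a)) as Hline.
{ intros e He.
  pose (P := fun t => a <= t <= b /\
    forall s, a <= s <= t -> phi s <= phi a + (c + e) * (s - a)).
  assert (P a) as Pa.
  { split; [lra|]; intros s Hs; replace s with a by lra; lra. }
  destruct (completeness P) as [tau [Hub Hleast]].
  { exists b; intros t [Ht _]; lra. }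
  { exists a; exact Pa. }
  pose proof (Hub a Pa) as Hatau.
  assert (tau <= b) as Htaub by (apply Hleast; intros t [Ht _]; lra).
  assert (forall s, a <= s < tau -> phi s <= phi a + (c + e) * (s - a)) as Hbefore.
  { intros s Hs; apply Rnot_lt_le; intros Hlt.
    assert (tau <= s); [|lra].
    apply Hleast; intros t [Ht HPt]; apply Rnot_lt_le; intros Hst.
    pose proof (HPt s ltac:(lra)); lra. }
  assert (phi tau <= phi a + (c + e) * (tau - a)) as Htau.
  { destruct (Req_dec tau a) as [->|Hne]; [lra|].
    apply Rnot_lt_le; intros Hlt.
    set (d := phi tau - (phi a + (c + e) * (tau - a))) in *.
    assert (0 < d) as Hd by (unfold d; lra).
    destruct (Hjump tau ltac:(lra) (d / 4) ltac:(lra)) as [eta [Heta Hs]].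
    pose proof (Rabs_pos (c + e)) as Hce.
    set (q := Rmin (Rmin (eta / 2) (d / (4 * (1 + Rabs (c + e))))) (tau - a)).
    assert (0 < q) as Hq.
    { unfold q; repeat apply Rmin_pos; try lra; apply Rdiv_lt_0_compat; lra. }
    assert (q <= eta / 2) by
      (unfold q; eapply Rle_trans; [apply Rmin_l|apply Rmin_l]).
    assert (q <= tau - a) by (unfold q; apply Rmin_r).
    assert (q * Rabs (c + e) <= d / 4) as Hqd.
    { apply Rle_trans with (d / (4 * (1 + Rabs (c + e))) * (1 + Rabs (c + e)));
        [|right; field; lra].
      apply Rmult_le_compat; try lra.
      unfold q; eapply Rle_trans; [apply Rmin_l|apply Rmin_r]. }
    pose proof (Hs (tau - q) ltac:(lra) ltac:(lra)) as H1.
    pose proof (Hbefore (tau - q) ltac:(lra)) as H2.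
    pose proof (Rle_abs (- (c + e))) as H3; rewrite Rabs_Ropp in H3.
    pose proof (Rmult_le_compat_l q _ _ (Rlt_le _ _ Hq) H3) as H4.
    unfold d in *; lra. }
  destruct (Req_dec tau b) as [<-|Hne]; [exact Htau|exfalso].
  destruct (Hdini tau ltac:(lra)) with (eps := e) as [eta [Heta Hk]]; [|lra|].
  { apply Rle_trans with (1 := Htau); apply Rplus_le_compat_l, Rmult_le_compat_r; lra. }
  set (q := Rmin eta (b - tau)).
  assert (0 < q) as Hq by (apply Rmin_pos; lra).
  assert (q <= eta) by apply Rmin_l.
  assert (q <= b - tau) by apply Rmin_r.
  assert (P (tau + q)) as HP.
  { split; [lra|]; intros s Hs.
    destruct (Rlt_le_dec s tau) as [Hst|Hst]; [apply Hbefore; lra|].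
    pose proof (Hk (s - tau) ltac:(lra)) as H1.
    replace (tau + (s - tau)) with s in H1 by ring.
    lra. }
  pose proof (Hub _ HP); lra. }
apply Rnot_lt_le; intros Hlt.
set (d := phi b - (phi a + c * (b - a))) in *.
assert (0 < d) as Hd by (unfold d; lra).
assert (0 < d / (2 * (b - a + 1))) as Hd2 by (apply Rdiv_lt_0_compat; lra).
set (e := Rmin e0 (d / (2 * (b - a + 1)))).
assert (0 < e) as He by (apply Rmin_pos; lra).
pose proof (Hline e (conj He (Rmin_l _ _))) as H.
assert (e * (b - a) <= d / 2).
{ apply Rle_trans with (d / (2 * (b - a + 1)) * (b - a + 1)); [|right; field; lra].
  apply Rmult_le_compat; try lra; apply Rmin_r. }
unfold d in *; lra.
Qed.

(** * Sequential completeness and the uniform boundedness principle *)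

(** Cauchy sequences rather than Cauchy filters, so that the property passes to the
    product of two complete spaces coordinate by coordinate. *)
Definition sequentially_complete (E : NormedModule R_AbsRing) : Prop :=
  forall u : nat -> E,
  (forall eps, 0 < eps -> exists N, forall m n, (N <= m)%nat -> (N <= n)%nat ->
     norm (minus (u m) (u n)) < eps) ->
  exists l, forall eps, 0 < eps -> exists N, forall n, (N <= n)%nat ->
     norm (minus (u n) l) < eps.

Lemma complete_sequentially (E : CompleteNormedModule R_AbsRing) : sequentially_complete E.
Proof.
intros u Hu.
assert (ProperFilter (filtermap u eventually)) as PF
  by (apply filtermap_proper_filter, eventually_filter).
assert (cauchy (filtermap u eventually)) as Hc.
{ intros eps; destruct (Hu eps (cond_pos eps)) as [N HN].
  exists (u N), N; intros n Hn; apply (norm_compat1 (u N : E) (u n) eps).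
  apply HN; lia. }
pose proof (complete_cauchy _ PF Hc) as Hlim.
exists (lim (filtermap u eventually)); intros eps Heps.
assert (0 < @norm_factor R_AbsRing E) as Hnf by apply norm_factor_gt_0.
assert (0 < eps / @norm_factor R_AbsRing E) as He by (apply Rdiv_lt_0_compat; assumption).
destruct (Hlim (mkposreal _ He)) as [N HN]; exists N; intros n Hn.
replace eps with (@norm_factor R_AbsRing E * (eps / @norm_factor R_AbsRing E))
  by (field; lra).
exact (norm_compat2 (lim (filtermap u eventually) : E) (u n) (mkposreal _ He) (HN n Hn)).
Qed.

Lemma norm_prod_le {E1 E2 : NormedModule R_AbsRing} (p : prod_NormedModule R_AbsRing E1 E2) :
  norm p <= norm (fst p) + norm (snd p).
Proof.
pose proof (norm_ge_0 (fst p)); pose proof (norm_ge_0 (snd p)).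
change (sqrt (norm (fst p) ^ 2 + norm (snd p) ^ 2) <= norm (fst p) + norm (snd p)).
rewrite <- (sqrt_pow2 (norm (fst p) + norm (snd p))) by lra.
apply sqrt_le_1_alt; nra.
Qed.

Lemma norm2_prod {E1 E2 : NormedModule R_AbsRing} (p : prod_NormedModule R_AbsRing E1 E2) :
  norm p ^ 2 = norm (fst p) ^ 2 + norm (snd p) ^ 2.
Proof.
change (sqrt (norm (fst p) ^ 2 + norm (snd p) ^ 2) ^ 2
  = norm (fst p) ^ 2 + norm (snd p) ^ 2).
apply pow2_sqrt; nra.
Qed.

Lemma norm_fst_le {E1 E2 : NormedModule R_AbsRing} (p : prod_NormedModule R_AbsRing E1 E2) :
  norm (fst p) <= norm p.
Proof.
apply Rsqr_incr_0_var; [|apply norm_ge_0]; unfold Rsqr.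
pose proof (norm2_prod p); nra.
Qed.

Lemma norm_snd_le {E1 E2 : NormedModule R_AbsRing} (p : prod_NormedModule R_AbsRing E1 E2) :
  norm (snd p) <= norm p.
Proof.
apply Rsqr_incr_0_var; [|apply norm_ge_0]; unfold Rsqr.
pose proof (norm2_prod p); nra.
Qed.

Lemma prod_sequentially_complete (E1 E2 : NormedModule R_AbsRing) :
  sequentially_complete E1 -> sequentially_complete E2 ->
  sequentially_complete (prod_NormedModule R_AbsRing E1 E2).
Proof.
intros H1 H2 u Hu.
destruct (H1 (fun n => fst (u n))) as [l1 Hl1].
{ intros eps Heps; destruct (Hu eps Heps) as [N HN]; exists N; intros m n Hm Hn.
  apply Rle_lt_trans with (2 := HN m n Hm Hn); exact (norm_fst_le (minus (u m) (u n))). }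
destruct (H2 (fun n => snd (u n))) as [l2 Hl2].
{ intros eps Heps; destruct (Hu eps Heps) as [N HN]; exists N; intros m n Hm Hn.
  apply Rle_lt_trans with (2 := HN m n Hm Hn); exact (norm_snd_le (minus (u m) (u n))). }
exists (l1, l2); intros eps Heps.
destruct (Hl1 (eps / 2) ltac:(lra)) as [N1 HN1].
destruct (Hl2 (eps / 2) ltac:(lra)) as [N2 HN2].
exists (N1 + N2)%nat; intros n Hn.
apply Rle_lt_trans with (1 := norm_prod_le (minus (u n) (l1, l2))).
pose proof (HN1 n ltac:(lia)) as G1; pose proof (HN2 n ltac:(lia)) as G2.
change (norm (minus (fst (u n)) l1) + norm (minus (snd (u n)) l2) < eps).
lra.
Qed.

(** One of the two points [x + z], [x - z] works when [z] nearly realizes the operator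
    norm, since their images differ by twice the image of [z]. *)
Lemma opnorm_attained_near {E F : NormedModule R_AbsRing} (L : Lop E F) (x : E) (r k : R) :
  0 < r -> k < r * opnorm L ->
  exists x', norm (minus x' x) <= r /\ k < norm (L x').
Proof.
intros Hr Hk; destruct (opnorm_is_lub L) as [_ Hleast].
assert (exists y, norm y <= 1 /\ k < r * norm (L y)) as [y [Hy Hky]].
{ apply Classical_Prop.NNPP; intros Hn.
  assert (opnorm L <= k / r) as H.
  { apply Hleast; intros s [y [Hy ->]]; apply Rnot_lt_le; intros Hlt; apply Hn.
    exists y; split; [exact Hy|].
    apply (Rmult_lt_compat_l r) in Hlt; [|exact Hr].
    replace (r * (k / r)) with k in Hlt by (field; lra); exact Hlt. }
  apply (Rmult_le_compat_l r) in H; [|lra].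
  replace (r * (k / r)) with k in H by (field; lra); lra. }
set (z := scal r y : E).
assert (norm z <= r) as Hz.
{ unfold z; rewrite norm_scal_R_eq, Rabs_pos_eq by lra; nra. }
assert (k < norm (L z)) as HLz.
{ unfold z; rewrite (linear_scal _ (Lop_linear L)), norm_scal_R_eq, Rabs_pos_eq by lra.
  exact Hky. }
destruct (Rlt_le_dec k (norm (L (plus x z)))) as [H|H].
{ exists (plus x z); split; [|exact H].
  replace (minus (plus x z) x) with z by (vec E); exact Hz. }
exists (minus x z); split.
- replace (minus (minus x z) x) with (opp z) by (vec E); rewrite norm_opp; exact Hz.
- pose proof (norm_minus_le (L (plus x z)) (L (minus x z))) as H1.
  replace (minus (L (plus x z)) (L (minus x z))) with (scal 2 (L z)) in H1.
  + rewrite norm_scal_R_eq, Rabs_pos_eq in H1 by lra; lra.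
  + rewrite (linear_minus _ _ _ (Lop_linear L)), (linear_plus _ (Lop_linear L)); vec F.
Qed.

(** Gliding hump: from operators [L n] of norm larger than [n * 3 ^ (n + 1)], build points
    [x n] with increments at most [3 ^ - (n + 1)] at which [L n] is large.  The tail of the
    increments is too short to spoil this, so the [L n] are unbounded at the limit. *)
Theorem uniform_boundedness {E F : NormedModule R_AbsRing} (P : Lop E F -> Prop) :
  sequentially_complete E ->
  (forall x, exists K, forall L, P L -> norm (L x) <= K) ->
  exists K, forall L, P L -> opnorm L <= K.
Proof.
intros HE Hpt; apply Classical_Prop.NNPP; intros Hn.
assert (forall K, exists L, P L /\ K < opnorm L) as Hlarge.
{ intros K; apply Classical_Prop.NNPP; intros Hn'; apply Hn; exists K.
  intros L HL; apply Rnot_lt_le; intros Hlt; apply Hn'; exists L; tauto. }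
pose (Ls := fun n : nat => proj1_sig
  (constructive_indefinite_description _ (Hlarge (INR n * 3 ^ S n)))).
assert (forall n, P (Ls n) /\ INR n * 3 ^ S n < opnorm (Ls n)) as HLs
  by (intros n; exact (proj2_sig
        (constructive_indefinite_description _ (Hlarge (INR n * 3 ^ S n))))).
set (d := fun n : nat => / 3 ^ n).
assert (forall n, 0 < d n) as Hd
  by (intros n; apply Rinv_0_lt_compat, pow_lt; lra).
assert (forall n, d (S n) = d n / 3) as HdS.
{ intros n; unfold d; simpl; field; apply pow_nonzero; lra. }
assert (forall n, opnorm (Ls n) > 0) as Hop.
{ intros n; apply Rle_lt_trans with (2 := proj2 (HLs n)).
  apply Rmult_le_pos; [apply pos_INR|apply pow_le; lra]. }
assert (forall (n : nat) (x : E), exists x', norm (minus x' x) <= d (S n) /\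
  2 / 3 * d (S n) * opnorm (Ls n) < norm (Ls n x')) as Hstep.
{ intros n x; apply opnorm_attained_near; [apply Hd|].
  pose proof (Rmult_lt_0_compat _ _ (Hd (S n)) (Hop n)); lra. }
pose (step := fun n x => proj1_sig (constructive_indefinite_description _ (Hstep n x))).
pose (xs := fix xs n : E := match n with O => zero | S m => step m (xs m) end).
assert (forall n, norm (minus (xs (S n)) (xs n)) <= d (S n) /\
  2 / 3 * d (S n) * opnorm (Ls n) < norm (Ls n (xs (S n)))) as Hxs
  by (intros n; exact (proj2_sig (constructive_indefinite_description _ (Hstep n (xs n))))).
assert (forall k n, norm (minus (xs (n + k)%nat) (xs n)) <= d n / 2 - d (n + k)%nat / 2)
  as Htail.
{ induction k as [|k IH]; intros n.
  - rewrite Nat.add_0_r, norm_minus_diag; lra.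
  - rewrite Nat.add_succ_r.
    apply Rle_trans with (1 := norm_minus_triangle _ (xs (n + k)%nat) _).
    pose proof (proj1 (Hxs (n + k)%nat)); pose proof (IH n).
    rewrite (HdS (n + k)%nat) in *; lra. }
assert (forall n m, (n <= m)%nat -> norm (minus (xs m) (xs n)) <= d n / 2) as Htail'.
{ intros n m Hnm; replace m with (n + (m - n))%nat by lia.
  pose proof (Htail (m - n)%nat n); pose proof (Hd (n + (m - n))%nat); lra. }
destruct (HE xs) as [x Hx].
{ intros eps Heps.
  destruct (pow_lt_1_zero (/ 3)) with (y := eps) as [N HN];
    [rewrite Rabs_pos_eq; lra|exact Heps|].
  exists N; intros m n Hm Hn'.
  specialize (HN N (Nat.le_refl N)).
  rewrite pow_inv, Rabs_pos_eq in HN by (apply Rlt_le; apply (Hd N)).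
  apply Rle_lt_trans with (2 := HN).
  apply Rle_trans with (1 := norm_minus_triangle _ (xs N) _).
  rewrite (norm_minus_sym (xs N)).
  pose proof (Htail' N m Hm); pose proof (Htail' N n Hn'); fold (d N); lra. }
assert (forall n, norm (minus x (xs n)) <= d n / 2) as Hxn.
{ intros n; apply Rnot_lt_le; intros Hlt.
  destruct (Hx (norm (minus x (xs n)) - d n / 2)) as [N HN]; [lra|].
  pose proof (HN (N + n)%nat ltac:(lia)) as H1.
  pose proof (Htail' n (N + n)%nat ltac:(lia)) as H2.
  pose proof (norm_minus_triangle x (xs (N + n)%nat) (xs n)) as H3.
  rewrite (norm_minus_sym x (xs (N + n)%nat)) in H3; lra. }
destruct (Hpt x) as [K HK].
destruct (INR_unbounded (6 * K)) as [n Hnk].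
pose proof (HK _ (proj1 (HLs n))) as H1.
pose proof (proj2 (Hxs n)) as H2.
pose proof (opnorm_bound (Ls n) (minus x (xs (S n)))) as H3.
rewrite (linear_minus _ _ _ (Lop_linear (Ls n))) in H3.
pose proof (norm_le_minus (Ls n (xs (S n))) (Ls n x)) as H4.
rewrite norm_minus_sym in H4.
pose proof (Rmult_le_compat_l _ _ _ (Rlt_le _ _ (Hop n)) (Hxn (S n))) as H5.
pose proof (Rmult_lt_compat_l _ _ _ (Hd (S n)) (proj2 (HLs n))) as H6.
replace (d (S n) * (INR n * 3 ^ S n)) with (INR n) in H6
  by (unfold d; field; apply pow_nonzero; lra).
lra.
Qed.

(** * Bounded operators and adjoints *)

Definition Lop_comp {E1 E2 E3 : NormedModule R_AbsRing} (L : Lop E2 E3) (M : Lop E1 E2) :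
  Lop E1 E3 :=
  mkLop (fun x => L (M x)) (is_linear_comp M L (Lop_linear M) (Lop_linear L)).

Lemma opnorm_comp {E1 E2 E3 : NormedModule R_AbsRing} (L : Lop E2 E3) (M : Lop E1 E2) :
  opnorm (Lop_comp L M) <= opnorm L * opnorm M.
Proof.
pose proof (opnorm_ge_0 L); pose proof (opnorm_ge_0 M).
apply opnorm_le; [nra|]; intros x; simpl.
apply Rle_trans with (1 := opnorm_bound L (M x)).
pose proof (Rmult_le_compat_l _ _ _ (opnorm_ge_0 L) (opnorm_bound M x)); lra.
Qed.

Section Adjoint.
Context {H1 H2 : HilbertSpace}.

Lemma norm_adjoint_le (L : Lop H1 H2) (y : H2) :
  norm (adjoint L y) <= opnorm L * norm y.
Proof.
pose proof (adjointP L (adjoint L y) y) as H; rewrite inner_norm in H.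
pose proof (Rle_abs (inner (L (adjoint L y)) y)) as H3.
pose proof (cauchy_schwarz (L (adjoint L y)) y) as H4.
pose proof (opnorm_bound L (adjoint L y)) as H5.
pose proof (norm_ge_0 y) as Hy; pose proof (norm_ge_0 (adjoint L y)) as Ha.
pose proof (opnorm_ge_0 L) as HL.
pose proof (Rmult_le_compat_r _ _ _ Hy H5) as H6.
apply Rnot_lt_le; intros Hlt.
assert (0 < norm (adjoint L y)) as Ha'.
{ apply Rle_lt_trans with (2 := Hlt); apply Rmult_le_pos; assumption. }
pose proof (Rmult_lt_compat_l _ _ _ Ha' Hlt); simpl in H; lra.
Qed.

Lemma adjoint_minus (L M : Lop H1 H2) (y : H2) :
  adjoint (minus L M) y = minus (adjoint L y) (adjoint M y).
Proof.
apply inner_eq; intros v.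
rewrite (inner_sym _ v), <- adjointP, (inner_sym _ v).
transitivity (inner v (adjoint L y) - inner v (adjoint M y)); [|symmetry; apply inner_minus_r].
rewrite <- !adjointP; apply inner_minus_l.
Qed.

Lemma norm_adjoint_minus_le (L M : Lop H1 H2) (y : H2) :
  norm (minus (adjoint L y) (adjoint M y)) <= opnorm (minus L M) * norm y.
Proof. rewrite <- adjoint_minus; apply norm_adjoint_le. Qed.

(** The functionals [inner y] with [norm (adjoint L y) <= 1] are bounded at every point
    [L u], by the norm of [u].  As [L] is onto, the uniform boundedness principle bounds
    those [y]. *)
Lemma adjoint_bounded_below (L : Lop H1 H2) :
  (forall y, exists u, L u = y) ->
  exists c, 0 < c /\ forall y, c * norm y <= norm (adjoint L y).
Proof.
intros Hsurj.
pose (P := fun phi : Lop H2 R_NormedModule =>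
  exists y, norm (adjoint L y) <= 1 /\ forall v, phi v = inner y v).
destruct (uniform_boundedness P) as [K HK].
- apply complete_sequentially.
- intros v; destruct (Hsurj v) as [u <-]; exists (norm u); intros phi [y [Hy Hphi]].
  rewrite Hphi, inner_sym, adjointP.
  apply Rle_trans with (1 := cauchy_schwarz u (adjoint L y)).
  pose proof (norm_ge_0 u); nra.
- assert (forall y, norm (adjoint L y) <= 1 -> norm y <= Rmax K 0) as Hball.
  { intros y Hy.
    assert (is_linear (fun v => inner y v : R_NormedModule)) as Hl.
    { constructor.
      - intros u v; apply inner_plus_r.
      - intros k v; apply inner_scal_r.
      - exists (norm y + 1); split; [pose proof (norm_ge_0 y); lra|].
        intros v; apply Rle_trans with (1 := cauchy_schwarz y v).
        pose proof (norm_ge_0 v); nra. }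
    assert (opnorm (mkLop _ Hl) <= K) as Hop
      by (apply HK; exists y; split; [exact Hy|reflexivity]).
    pose proof (opnorm_bound (mkLop _ Hl) y) as H.
    change (Rabs (inner y y) <= opnorm (mkLop _ Hl) * norm y) in H.
    rewrite inner_norm, Rabs_pos_eq in H by apply pow2_ge_0.
    pose proof (norm_ge_0 y) as Hy0.
    apply Rnot_lt_le; intros Hlt.
    pose proof (Rmax_l K 0); pose proof (Rmax_r K 0); nra. }
  set (m := Rmax K 0) in *; assert (0 <= m) as Hm by apply Rmax_r.
  exists (/ (m + 1)); split; [apply Rinv_0_lt_compat; lra|]; intros y.
  apply (Rmult_le_reg_l (m + 1)); [lra|].
  rewrite <- Rmult_assoc, Rinv_r, Rmult_1_l by lra.
  pose proof (norm_ge_0 y) as Hy; pose proof (norm_ge_0 (adjoint L y)) as Ha.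
  assert (forall s : R, 0 <= s -> s * norm (adjoint L y) <= 1 -> s * norm y <= m) as Hs.
  { intros s Hs Hsa.
    pose proof (Hball (scal s y)) as H.
    rewrite (linear_scal _ (Lop_linear (adjoint L))) in H.
    assert (forall (E : NormedModule R_AbsRing) (x : E), norm (scal s x) = s * norm x) as Hn
      by (intros E x; rewrite norm_scal_R_eq, Rabs_pos_eq; [reflexivity|exact Hs]).
    apply Rle_trans with (norm (scal s y : H2)); [right; symmetry; exact (Hn H2 y)|].
    apply H; apply Rle_trans with (2 := Hsa); right; exact (Hn H1 (adjoint L y)). }
  apply Rnot_lt_le; intros Hlt.
  assert (0 < norm y) as Hy0 by nra.
  assert (0 <= (m + 1) / norm y) as Hs0 by (apply Rdiv_le_0_compat; lra).
  pose proof (Hs ((m + 1) / norm y) Hs0) as H.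
  replace ((m + 1) / norm y * norm y) with (m + 1) in H by (field; lra).
  enough (m + 1 <= m) by lra; apply H.
  apply (Rmult_le_reg_l (norm y)); [exact Hy0|].
  replace (norm y * ((m + 1) / norm y * norm (adjoint L y)))
    with ((m + 1) * norm (adjoint L y)) by (field; lra).
  lra.
Qed.

End Adjoint.

Lemma adjoint_comp {H1 H2 H3 : HilbertSpace} (L : Lop H2 H3) (M : Lop H1 H2) (y : H3) :
  adjoint (Lop_comp L M) y = adjoint M (adjoint L y).
Proof.
apply inner_eq; intros v.
rewrite (inner_sym _ v), (inner_sym _ v), <- !adjointP; reflexivity.
Qed.

(** * Strongly continuous semigroups *)

Section Semigroup.
Context {E : NormedModule R_AbsRing} (T : R -> Lop E E) (HT : C0_semigroup T).

Lemma semigroup_near_0 (x : E) (eps : R) :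
  0 < eps -> exists eta, 0 < eta /\ forall k, 0 <= k < eta -> norm (minus (T k x) x) < eps.
Proof.
intros Heps; destruct HT as [HT0 [_ HTc]].
destruct (proj1 (filterlim_at_right_0_iff _ _) (HTc x) eps Heps) as [eta [Heta H]].
exists eta; split; [exact Heta|]; intros k Hk.
destruct (Req_dec k 0) as [->|Hk0]; [|apply H; lra].
rewrite HT0, norm_minus_diag; exact Heps.
Qed.

Lemma initial_segment_bounded (u : nat -> R) (N : nat) :
  exists K, forall n, (n < N)%nat -> u n <= K.
Proof.
induction N as [|N [K HK]]; [exists 0; intros; lia|].
exists (Rmax K (u N)); intros n Hn.
destruct (Nat.eq_dec n N) as [->|Hne]; [apply Rmax_r|].
apply Rle_trans with (2 := Rmax_l _ _); apply HK; lia.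
Qed.

(** If not, some [T (t n)] with [t n] tending to [0] would have unbounded norms, although
    [T (t n) x] converges for every [x]. *)
Lemma semigroup_bounded_near_0 :
  sequentially_complete E ->
  exists K delta, 0 < delta /\ 1 <= K /\ forall t, 0 <= t <= delta -> opnorm (T t) <= K.
Proof.
intros HE; apply Classical_Prop.NNPP; intros Hn.
assert (forall n : nat, exists t, 0 <= t <= / (INR n + 1) /\ INR n + 1 < opnorm (T t))
  as Hlarge.
{ intros n; pose proof (pos_INR n).
  apply Classical_Prop.NNPP; intros Hn'; apply Hn.
  exists (INR n + 1), (/ (INR n + 1)); repeat split; try lra.
  - apply Rinv_0_lt_compat; lra.
  - intros t Ht; apply Rnot_lt_le; intros Hlt; apply Hn'; exists t; tauto. }
pose (ts := fun n => proj1_sig (constructive_indefinite_description _ (Hlarge n))).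
assert (forall n, 0 <= ts n <= / (INR n + 1) /\ INR n + 1 < opnorm (T (ts n))) as Hts
  by (intros n; exact (proj2_sig (constructive_indefinite_description _ (Hlarge n)))).
destruct (uniform_boundedness (fun L => exists n, L = T (ts n)) HE) as [K HK].
- intros x; destruct (semigroup_near_0 x 1 Rlt_0_1) as [eta [Heta Hx]].
  destruct (INR_unbounded (/ eta)) as [N HN].
  destruct (initial_segment_bounded (fun n => norm (T (ts n) x)) N) as [K HK].
  exists (Rmax K (norm x + 1)); intros L [n ->].
  destruct (Nat.lt_ge_cases n N) as [Hn'|Hn'].
  + apply Rle_trans with (2 := Rmax_l _ _); apply HK; exact Hn'.
  + apply Rle_trans with (2 := Rmax_r _ _).
    apply Rle_trans with (1 := norm_le_minus _ x).
    apply Rplus_le_compat_l, Rlt_le, Hx.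
    destruct (Hts n) as [[Ht0 Ht1] _]; split; [exact Ht0|].
    apply Rle_lt_trans with (1 := Ht1).
    rewrite <- (Rinv_inv eta); apply Rinv_lt_contravar.
    * pose proof (pos_INR n); apply Rmult_lt_0_compat; [apply Rinv_0_lt_compat|]; lra.
    * apply le_INR in Hn'; lra.
- destruct (INR_unbounded K) as [n HnK].
  pose proof (HK (T (ts n)) (ex_intro _ n eq_refl)); pose proof (proj2 (Hts n)); lra.
Qed.

Section Bounded.
Context (K delta : R)
  (Hbound : forall t, 0 <= t <= delta -> opnorm (T t) <= K).

Lemma semigroup_norm_le (t : R) (x : E) : 0 <= t <= delta -> norm (T t x) <= K * norm x.
Proof.
intros Ht; apply Rle_trans with (1 := opnorm_bound (T t) x).
apply Rmult_le_compat_r; [apply norm_ge_0|exact (Hbound t Ht)].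
Qed.

Lemma semigroup_continuous_le (s t : R) (x : E) :
  0 <= s <= delta -> 0 <= t <= delta ->
  norm (minus (T t x) (T s x)) <= K * norm (minus (T (Rabs (t - s)) x) x).
Proof.
destruct HT as [_ [HTp _]].
assert (forall s t, 0 <= s <= t -> t <= delta ->
  norm (minus (T t x) (T s x)) <= K * norm (minus (T (Rabs (t - s)) x) x)) as H.
{ clear s t; intros s t Hs Ht; rewrite (Rabs_pos_eq (t - s)) by lra.
  replace (T t x) with (T s (T (t - s) x)) by (rewrite <- HTp by lra; do 2 f_equal; ring).
  rewrite <- (linear_minus _ _ _ (Lop_linear (T s))); apply semigroup_norm_le; lra. }
intros Hs Ht; destruct (Rle_dec s t) as [Hst|Hst]; [apply H; lra|].
rewrite norm_minus_sym, Rabs_minus_sym; apply H; lra.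
Qed.

End Bounded.

Section Generator.
Context {D : E -> Prop} {A : E -> E} (HA : infinitesimal_generator T D A).

(** Expansions of orbits at [0] can be added, scaled and transported by the semigroup, which
    yields at once the linearity of the generator and the invariance of its domain. *)
Lemma generator_expansion (x y : E) :
  D x /\ A x = y <->
  forall eps, 0 < eps -> exists eta, 0 < eta /\ forall k, 0 < k < eta ->
    norm (minus (minus (T k x) x) (scal k y)) <= eps * k.
Proof.
destruct HA as [HD HAx].
assert (forall k z, 0 < k -> norm (minus (minus (T k x) x) (scal k z))
  = k * norm (minus (scal (/ k) (minus (T k x) x)) z)) as Hk.
{ intros k z Hk; rewrite <- (Rabs_pos_eq k) at 3 by lra.
  rewrite <- norm_scal_R_eq; f_equal; vec E; lra. }
split.
- intros [Hx <-] eps Heps.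
  destruct (proj1 (filterlim_at_right_0_iff _ _) (HAx x Hx) eps Heps) as [eta [Heta H]].
  exists eta; split; [exact Heta|]; intros k Hk'; rewrite Hk by lra.
  rewrite Rmult_comm; apply Rmult_le_compat_r; [lra|]; apply Rlt_le, H, Hk'.
- intros H.
  assert (filterlim (fun t => scal (/ t) (minus (T t x) x)) (at_right 0) (locally y)) as Hl.
  { apply filterlim_at_right_0_iff; intros eps Heps.
    destruct (H (eps / 2) ltac:(lra)) as [eta [Heta H']].
    exists eta; split; [exact Heta|]; intros k Hk'.
    specialize (H' k Hk'); rewrite Hk, Rmult_comm in H' by lra.
    apply Rle_lt_trans with (eps / 2); [|lra].
    apply (Rmult_le_reg_r k); [lra|exact H']. }
  assert (D x) as Hx by (apply HD; exists y; exact Hl).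
  split; [exact Hx|]; exact (filterlim_locally_unique _ _ _ (HAx x Hx) Hl).
Qed.

Lemma generator_plus (x y : E) :
  D x -> D y -> D (plus x y) /\ A (plus x y) = plus (A x) (A y).
Proof.
intros Hx Hy; apply generator_expansion; intros eps Heps.
destruct (proj1 (generator_expansion x _) (conj Hx eq_refl) (eps / 2) ltac:(lra))
  as [e1 [He1 H1]].
destruct (proj1 (generator_expansion y _) (conj Hy eq_refl) (eps / 2) ltac:(lra))
  as [e2 [He2 H2]].
exists (Rmin e1 e2); split; [apply Rmin_pos; assumption|]; intros k [Hk0 Hk].
pose proof (H1 k (conj Hk0 (Rlt_le_trans _ _ _ Hk (Rmin_l _ _)))).
pose proof (H2 k (conj Hk0 (Rlt_le_trans _ _ _ Hk (Rmin_r _ _)))).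
rewrite (linear_plus _ (Lop_linear (T k))).
norm_as E (plus (minus (minus (T k x) x) (scal k (A x)))
  (minus (minus (T k y) y) (scal k (A y)))).
apply Rle_trans with (1 := norm_triangle _ _); lra.
Qed.

Lemma generator_scal (a : R) (x : E) :
  D x -> D (scal a x) /\ A (scal a x) = scal a (A x).
Proof.
intros Hx; apply generator_expansion; intros eps Heps.
pose proof (Rabs_pos a).
destruct (proj1 (generator_expansion x _) (conj Hx eq_refl) (eps / (Rabs a + 1)))
  as [e1 [He1 H1]]; [apply Rdiv_lt_0_compat; lra|].
exists e1; split; [exact He1|]; intros k Hk.
rewrite (linear_scal _ (Lop_linear (T k))).
norm_as E (scal a (minus (minus (T k x) x) (scal k (A x)))).
apply Rle_trans with (1 := norm_scal_le _ _).
apply Rle_trans with (Rabs a * (eps / (Rabs a + 1) * k)).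
{ apply Rmult_le_compat_l; [lra|apply H1, Hk]. }
apply Rle_trans with ((Rabs a + 1) * (eps / (Rabs a + 1) * k)); [|right; field; lra].
apply Rmult_le_compat_r; [|lra].
apply Rmult_le_pos; [apply Rlt_le, Rdiv_lt_0_compat|]; lra.
Qed.

Lemma generator_semigroup (s : R) (x : E) : 0 <= s -> D x -> D (T s x).
Proof.
intros Hs Hx; destruct HT as [_ [HTp _]].
enough (D (T s x) /\ A (T s x) = T s (A x)) by tauto.
apply generator_expansion; intros eps Heps.
pose proof (opnorm_ge_0 (T s)).
destruct (proj1 (generator_expansion x _) (conj Hx eq_refl) (eps / (opnorm (T s) + 1)))
  as [e1 [He1 H1]]; [apply Rdiv_lt_0_compat; lra|].
exists e1; split; [exact He1|]; intros k Hk.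
rewrite <- HTp by lra; rewrite (Rplus_comm k s), HTp by lra.
rewrite <- (linear_minus _ _ _ (Lop_linear (T s))),
  <- (linear_scal _ (Lop_linear (T s))), <- (linear_minus _ _ _ (Lop_linear (T s))).
apply Rle_trans with (1 := opnorm_bound _ _).
apply Rle_trans with (opnorm (T s) * (eps / (opnorm (T s) + 1) * k)).
{ apply Rmult_le_compat_l; [lra|apply H1, Hk]. }
apply Rle_trans with ((opnorm (T s) + 1) * (eps / (opnorm (T s) + 1) * k));
  [|right; field; lra].
apply Rmult_le_compat_r; [|lra].
apply Rmult_le_pos; [apply Rlt_le, Rdiv_lt_0_compat|]; lra.
Qed.

End Generator.

Lemma is_RInt_linear {F : NormedModule R_AbsRing} (l : Lop E F) (f : R -> E) (a b : R) (I : E) :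
  is_RInt f a b I -> is_RInt (fun s => l (f s)) a b (l I).
Proof.
intros H; unfold is_RInt.
apply filterlim_ext with (fun ptd => l (scal (sign (b - a)) (Riemann_sum f ptd))).
- intros ptd; rewrite (linear_scal _ (Lop_linear l)); f_equal.
  apply (SF_cons_ind (fun s => l (Riemann_sum f s) = Riemann_sum (fun t => l (f t)) s)).
  + intros x; apply (linear_zero _ (Lop_linear l)).
  + intros h s IH; rewrite !Riemann_sum_cons, (linear_plus _ (Lop_linear l)), IH.
    f_equal; apply (linear_scal _ (Lop_linear l)).
- apply filterlim_comp with (1 := H); apply (linear_cont l I (Lop_linear l)).
Qed.

(** The mild formula may be restarted at any time: apply [T h] to the formula at time [t]
    and subtract it from the formula at time [t + h]. *)
Lemma mild_restart (F : E -> E) (w : R -> E) :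
  (forall t, 0 <= t ->
     is_RInt (fun s => T (t - s) (F (w s))) 0 t (minus (w t) (T t (w 0)))) ->
  forall t h, 0 <= t -> 0 <= h ->
    is_RInt (fun s => T (t + h - s) (F (w s))) t (t + h) (minus (w (t + h)) (T h (w t))).
Proof.
intros Hw t h Ht Hh; destruct HT as [_ [HTp _]].
replace (minus (w (t + h)) (T h (w t)))
  with (plus (opp (T h (minus (w t) (T t (w 0))))) (minus (w (t + h)) (T (t + h) (w 0)))).
- apply is_RInt_Chasles with 0; [|apply Hw; lra].
  apply is_RInt_swap.
  apply is_RInt_ext with (fun s => T h (T (t - s) (F (w s)))).
  + intros s; rewrite Rmin_left, Rmax_right by lra; intros Hs.
    rewrite <- HTp by lra; do 2 f_equal; ring.
  + apply is_RInt_linear, Hw, Ht.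
- rewrite (linear_minus _ _ _ (Lop_linear (T h))), (Rplus_comm t h), (HTp h t) by lra.
  vec E.
Qed.

End Semigroup.

(** The averages of an orbit over [t, 2 t] lie in the domain, the generator mapping
    them to a difference quotient of the orbit, and they converge to its initial point.
    The interval stays away from [0] since nothing is known of [T] at negative times. *)
Lemma generator_domain_dense {E : CompleteNormedModule R_AbsRing} (T : R -> Lop E E)
  (D : E -> Prop) (A : E -> E) :
  C0_semigroup T -> infinitesimal_generator T D A ->
  forall (x : E) eps, 0 < eps -> exists y, D y /\ norm (minus y x) < eps.
Proof.
intros HT HA x eps Heps.
destruct (semigroup_bounded_near_0 T HT (complete_sequentially E))
  as [K [delta [Hdelta [HK Hbound]]]].
pose proof (semigroup_continuous_le T HT K delta Hbound) as Hmod.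
pose proof HT as [HT0 [HTp HTc]].
assert (forall a e, 0 < a < delta -> 0 < e -> exists eta, 0 < eta /\
  forall s, Rabs (s - a) < eta -> norm (minus (T s x) (T a x)) < e) as Hcont.
{ intros a e Ha He.
  destruct (semigroup_near_0 T HT x (e / K)) as [eta [Heta Hx]];
    [apply Rdiv_lt_0_compat; lra|].
  exists (Rmin eta (Rmin a (delta - a))); split; [repeat apply Rmin_pos; lra|].
  intros s Hs.
  pose proof (Rmin_l eta (Rmin a (delta - a))); pose proof (Rmin_r eta (Rmin a (delta - a))).
  pose proof (Rmin_l a (delta - a)); pose proof (Rmin_r a (delta - a)).
  assert (0 <= s <= delta) as Hs' by (revert Hs; unfold Rabs; destruct Rcase_abs; lra).
  apply Rle_lt_trans with (1 := Hmod a s x ltac:(lra) Hs').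
  pose proof (Hx (Rabs (s - a)) ltac:(pose proof (Rabs_pos (s - a)); lra)) as H'.
  apply (Rmult_lt_compat_l K) in H'; [|lra].
  replace (K * (e / K)) with e in H' by (field; lra); exact H'. }
assert (forall a b, 0 < a < delta -> 0 < b < delta -> ex_RInt (fun s => T s x) a b) as Hex.
{ intros a b Ha Hb; apply ex_RInt_continuous; intros s Hs.
  assert (0 < s < delta) as Hs'
    by (revert Hs; unfold Rmin, Rmax; destruct Rle_dec; lra).
  apply (proj2 (filterlim_norm_iff (locally s) (fun s => T s x) (T s x))); intros e He.
  destruct (Hcont s e Hs' He) as [eta [Heta H]].
  exists (mkposreal eta Heta); exact H. }
set (J := fun a b => RInt (fun s => T s x) a b : E).
assert (forall a b, 0 < a < delta -> 0 < b < delta -> is_RInt (fun s => T s x) a b (J a b))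
  as HJ by (intros a b Ha Hb; apply (RInt_correct (fun s => T s x)), Hex; assumption).
assert (forall a e, 0 < a < delta -> 0 < e -> exists eta, 0 < eta /\
  forall k, 0 < k < eta -> norm (minus (J a (a + k)) (scal k (T a x))) <= k * e) as HJd.
{ intros a e Ha He; destruct (Hcont a e Ha He) as [eta [Heta H]].
  exists (Rmin eta (delta - a)); split; [apply Rmin_pos; lra|]; intros k Hk.
  pose proof (Rmin_l eta (delta - a)); pose proof (Rmin_r eta (delta - a)).
  replace k with (a + k - a) at 2 3 by ring.
  apply (norm_RInt_le_const (fun s => minus (T s x) (T a x)) a (a + k)); [lra| |].
  - intros s Hs; apply Rlt_le, H; rewrite Rabs_pos_eq; lra.
  - apply (is_RInt_minus (V := E)); [apply HJ; lra|].
    apply (is_RInt_const (V := E)). }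
destruct (semigroup_near_0 T HT x (eps / 2)) as [eta [Heta Hx]]; [lra|].
pose proof (Rmin_l eta delta); pose proof (Rmin_r eta delta).
set (t := Rmin eta delta / 4).
assert (0 < t) as Ht by (assert (0 < Rmin eta delta) by (apply Rmin_pos; lra); unfold t; lra).
assert (4 * t <= eta /\ 4 * t <= delta) as [Hteta Htdelta] by (unfold t; lra).
exists (scal (/ t) (J t (2 * t))); split.
- apply (generator_scal T HA).
  enough (D (J t (2 * t)) /\ A (J t (2 * t)) = minus (T (2 * t) x) (T t x)) by tauto.
  apply (generator_expansion T HA); intros e He.
  destruct (HJd t (e / 2)) as [e1 [He1 H1]]; [lra|lra|].
  destruct (HJd (2 * t) (e / 2)) as [e2 [He2 H2]]; [lra|lra|].
  exists (Rmin t (Rmin e1 e2)); split; [repeat apply Rmin_pos; lra|]; intros k Hk.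
  pose proof (Rmin_l t (Rmin e1 e2)); pose proof (Rmin_r t (Rmin e1 e2)).
  pose proof (Rmin_l e1 e2); pose proof (Rmin_r e1 e2).
  assert (T k (J t (2 * t)) = J (t + k) (2 * t + k)) as Hshift.
  { apply (filterlim_locally_unique (F := Riemann_fine t (2 * t))
      (fun ptd => scal (sign (2 * t - t)) (Riemann_sum (fun s => T k (T s x)) ptd))).
    - apply (is_RInt_linear (T k) (fun s => T s x)); apply HJ; lra.
    - apply (is_RInt_ext (fun s => scal 1 (T (1 * s + k) x))).
      + intros s; rewrite Rmin_left, Rmax_right by lra; intros Hs.
        rewrite <- HTp by lra.
        replace (1 * s + k) with (k + s) by ring; apply (scal_one (V := E)).
      + apply (is_RInt_comp_lin (V := E) (fun s => T s x) 1 k t (2 * t)).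
        rewrite !Rmult_1_l; apply HJ; lra. }
  assert (plus (J t (2 * t)) (J (2 * t) (2 * t + k))
    = plus (J t (t + k)) (J (t + k) (2 * t + k))) as Hch.
  { transitivity (J t (2 * t + k)); [|symmetry];
      apply (RInt_Chasles (fun s => T s x)); apply Hex; lra. }
  rewrite Hshift.
  assert (J (t + k) (2 * t + k)
    = minus (plus (J t (2 * t)) (J (2 * t) (2 * t + k))) (J t (t + k))) as ->
    by (rewrite Hch; vec E).
  norm_as E (minus (minus (J (2 * t) (2 * t + k)) (scal k (T (2 * t) x)))
    (minus (J t (t + k)) (scal k (T t x)))).
  apply Rle_trans with (1 := norm_minus_le (E := E) _ _).
  replace (e * k) with (k * (e / 2) + k * (e / 2)) by field.
  apply Rplus_le_compat; [apply H2|apply H1]; lra.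
- norm_as E (scal (/ t) (minus (J t (2 * t)) (scal (2 * t - t) x))); [|lra].
  assert (0 < / t) as Hit by (apply Rinv_0_lt_compat; exact Ht).
  apply Rle_lt_trans with (1 := norm_scal_le (E := E) _ _); rewrite Rabs_pos_eq by lra.
  assert (norm (minus (J t (2 * t)) (scal (2 * t - t) x) : E) <= (2 * t - t) * (eps / 2)) as H'.
  { apply (norm_RInt_le_const (fun s => minus (T s x) x)); [lra| |].
    - intros s Hs; apply Rlt_le, Hx; lra.
    - apply (is_RInt_minus (V := E)); [apply HJ; lra|apply (is_RInt_const (V := E))]. }
  apply (Rmult_le_compat_l (/ t)) in H'; [|lra].
  replace (/ t * ((2 * t - t) * (eps / 2))) with (eps / 2) in H' by (field; lra); lra.
Qed.

(** * Local Lipschitz bounds from differentials *)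

Definition lipschitz_near {E1 E2 : NormedModule R_AbsRing} (f : E1 -> E2) (x : E1) : Prop :=
  exists r k, 0 < r /\ 0 <= k /\ forall y z, norm (minus y x) < r -> norm (minus z x) < r ->
    norm (minus (f y) (f z)) <= k * norm (minus y z).

Lemma filterdiff_directional {E1 E2 : NormedModule R_AbsRing} (f : E1 -> E2) (l : Lop E1 E2)
  (x v : E1) :
  filterdiff f (locally x) l ->
  forall eps, 0 < eps -> exists eta, 0 < eta /\ forall k, 0 <= k <= eta ->
    norm (minus (minus (f (plus x (scal k v))) (f x)) (scal k (l v))) <= k * eps.
Proof.
intros Hf eps Heps.
pose proof (norm_ge_0 v) as Hv.
destruct (filterdiff_norm f x l Hf (eps / (norm v + 1))) as [eta [Heta H]];
  [apply Rdiv_lt_0_compat; lra|].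
assert (0 < eta / (2 * (norm v + 1))) as He by (apply Rdiv_lt_0_compat; lra).
exists (eta / (2 * (norm v + 1))); split; [exact He|]; intros k Hk.
assert (minus (plus x (scal k v)) x = scal k v) as Hm by (vec E1).
assert (norm (scal k v) <= k * norm v) as Hkv.
{ apply Rle_trans with (1 := norm_scal_le k v); rewrite Rabs_pos_eq; lra. }
assert (norm (minus (plus x (scal k v)) x) < eta) as Hlt.
{ rewrite Hm; apply Rle_lt_trans with (1 := Hkv).
  apply Rle_lt_trans with (eta / (2 * (norm v + 1)) * (norm v + 1)).
  - apply Rmult_le_compat; lra.
  - replace (eta / (2 * (norm v + 1)) * (norm v + 1)) with (eta / 2) by (field; lra); lra. }
specialize (H _ Hlt); rewrite Hm, (linear_scal _ (Lop_linear l)) in H.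
apply Rle_trans with (1 := H).
assert (0 < eps / (norm v + 1)) by (apply Rdiv_lt_0_compat; lra).
apply Rle_trans with (eps / (norm v + 1) * (k * (norm v + 1))).
- apply Rmult_le_compat_l; [lra|]; nra.
- right; field; lra.
Qed.

(** The mean value inequality, as a growth estimate for the distance to [f z] along the
    segment from [z] to [y]. *)
Lemma mean_value_ball {E1 E2 : NormedModule R_AbsRing} (f : E1 -> E2) (df : E1 -> Lop E1 E2)
  (x : E1) (r k : R) :
  (forall y, norm (minus y x) < r -> filterdiff f (locally y) (df y) /\ opnorm (df y) <= k) ->
  forall y z, norm (minus y x) < r -> norm (minus z x) < r ->
    norm (minus (f y) (f z)) <= k * norm (minus y z).
Proof.
intros Hdf y z Hy Hz.
set (v := minus y z).
set (p := fun t : R => plus z (scal t v)).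
assert (forall t, 0 <= t <= 1 -> norm (minus (p t) x) < r) as Hp.
{ intros t Ht; unfold p, v.
  norm_as E1 (plus (scal t (minus y x)) (scal (1 - t) (minus z x))).
  apply Rle_lt_trans with (1 := norm_triangle (V := E1) _ _).
  pose proof (norm_scal_le t (minus y x)) as H1.
  pose proof (norm_scal_le (1 - t) (minus z x)) as H2.
  rewrite Rabs_pos_eq in H1, H2 by lra.
  destruct (Req_dec t 0) as [->|Ht0]; nra. }
pose proof (norm_ge_0 v) as Hv.
assert (norm (minus (f (p 1)) (f z)) <= norm (minus (f (p 0)) (f z)) + k * norm v * (1 - 0))
  as H.
{ apply (dini_growth (fun t => norm (minus (f (p t)) (f z))) 0 1 (k * norm v) 1); try lra.
  - intros t Ht eps Heps.
    destruct (Hdf (p t) (Hp t ltac:(lra))) as [Hd _].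
    destruct (proj1 (continuous_norm_iff f (p t))) with (eps := eps) as [eta [Heta H]].
    + apply filterdiff_continuous; exists (df (p t)); exact Hd.
    + exact Heps.
    + assert (0 < eta / (norm v + 1)) as He by (apply Rdiv_lt_0_compat; lra).
      exists (eta / (norm v + 1)); split; [exact He|]; intros s Hs Hst.
      apply Rle_trans with (1 := norm_minus_triangle _ (f (p s)) _).
      rewrite Rplus_comm; apply Rplus_le_compat_l, Rlt_le.
      rewrite norm_minus_sym; apply H; unfold p.
      norm_as E1 (scal (s - t) v).
      apply Rle_lt_trans with (1 := norm_scal_le (E := E1) _ _).
      rewrite Rabs_minus_sym, Rabs_pos_eq by lra.
      apply Rle_lt_trans with ((t - s) * (norm v + 1)).
      * apply Rmult_le_compat_l; lra.
      * replace eta with (eta / (norm v + 1) * (norm v + 1)) by (field; lra).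
        apply Rmult_lt_compat_r; lra.
  - intros t Ht _ eps Heps.
    destruct (Hdf (p t) (Hp t ltac:(lra))) as [Hd Hk].
    destruct (filterdiff_directional f (df (p t)) (p t) v Hd eps Heps) as [eta [Heta H]].
    exists eta; split; [exact Heta|]; intros s Hs; specialize (H s Hs).
    replace (p (t + s)) with (plus (p t) (scal s v)) by (unfold p; vec E1).
    apply Rle_trans with (1 := norm_minus_triangle _ (f (p t)) _).
    rewrite Rplus_comm; apply Rplus_le_compat_l; rewrite Rmult_plus_distr_l.
    apply Rle_trans with (1 := norm_le_minus (E := E2) _ (scal s (df (p t) v))).
    apply Rplus_le_compat; [|exact H].
    apply Rle_trans with (1 := norm_scal_le (E := E2) _ _); rewrite Rabs_pos_eq by lra.
    apply Rmult_le_compat_l; [lra|].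
    apply Rle_trans with (1 := opnorm_bound (df (p t)) v).
    apply Rmult_le_compat_r; lra. }
replace (p 1) with y in H by (unfold p, v; vec E1).
replace (p 0) with z in H by (unfold p; vec E1).
rewrite norm_minus_diag in H; fold v; lra.
Qed.

Lemma C1_lipschitz_near {E1 E2 : NormedModule R_AbsRing} (f : E1 -> E2) (df : E1 -> Lop E1 E2)
  (x : E1) : is_C1 f df -> lipschitz_near f x.
Proof.
intros [Hd Hc].
destruct (proj1 (continuous_norm_iff df x) (Hc x) 1 Rlt_0_1) as [r [Hr H]].
exists r, (opnorm (df x) + 1); split; [exact Hr|].
split; [pose proof (opnorm_ge_0 (df x)); lra|].
apply mean_value_ball with df; intros y Hy; split; [apply Hd|].
pose proof (norm_le_minus (df y) (df x)) as H1; specialize (H y Hy).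
change (opnorm (df y) <= opnorm (df x) + opnorm (minus (df y) (df x))) in H1.
change (opnorm (minus (df y) (df x)) < 1) in H; lra.
Qed.

Lemma lipschitz_near_continuous {E1 E2 : NormedModule R_AbsRing} (f : E1 -> E2) (x : E1) :
  lipschitz_near f x -> continuous f x.
Proof.
intros [r [k [Hr [Hk H]]]]; apply continuous_norm_iff; intros eps Heps.
exists (Rmin r (eps / (k + 1))); split.
{ apply Rmin_pos; [exact Hr|apply Rdiv_lt_0_compat; lra]. }
intros y Hy; pose proof (norm_ge_0 (minus y x)).
pose proof (Rmin_l r (eps / (k + 1))); pose proof (Rmin_r r (eps / (k + 1))).
apply Rle_lt_trans with (1 := H y x ltac:(lra) ltac:(rewrite norm_minus_diag; lra)).
apply Rle_lt_trans with ((k + 1) * norm (minus y x)); [nra|].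
replace eps with ((k + 1) * (eps / (k + 1))) by (field; lra).
apply Rmult_lt_compat_l; lra.
Qed.

(** * Lyapunov functionals along mild solutions *)

Section MildSolutions.
Context {E : NormedModule R_AbsRing} (T : R -> Lop E E) (D : E -> Prop) (A : E -> E)
  (HT : C0_semigroup T) (HA : infinitesimal_generator T D A) (HE : sequentially_complete E)
  (HD : forall x eps, 0 < eps -> exists y, D y /\ norm (minus y x) < eps).

(** The path [T s p + s c] is a solution of the equation with the constant [c] as forcing
    up to the error [s (A c)]; for [p] and [c] in the domain it stays there and has a right
    derivative.  Unlike the Duhamel integral of [c], it requires no integration. *)
Lemma affine_path_right_derivative (p c : E) (s : R) :
  0 <= s -> D p -> D c ->
  D (plus (T s p) (scal s c)) /\
  forall eps, 0 < eps -> exists eta, 0 < eta /\ forall k, 0 <= k <= eta ->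
    norm (minus (minus (plus (T (s + k) p) (scal (s + k) c)) (plus (T s p) (scal s c)))
      (scal k (plus (A (plus (T s p) (scal s c))) (minus c (scal s (A c)))))) <= k * eps.
Proof.
intros Hs Hp Hc; pose proof HT as [HT0 [HTp _]].
pose proof (generator_semigroup T HT HA s p Hs Hp) as HTsp.
destruct (generator_scal T HA s c Hc) as [Hsc HAsc].
destruct (generator_plus T HA _ _ HTsp Hsc) as [Hv HAv].
split; [exact Hv|]; intros eps Heps.
destruct (proj1 (generator_expansion T HA (T s p) _) (conj HTsp eq_refl) eps Heps)
  as [eta [Heta H]].
exists (eta / 2); split; [lra|]; intros k Hk; rewrite HAv, HAsc.
norm_as E (minus (minus (T (s + k) p) (T s p)) (scal k (A (T s p)))).
destruct (Req_dec k 0) as [->|Hk0].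
- rewrite Rplus_0_r; norm_as E (zero : E); rewrite norm_zero; lra.
- rewrite (Rplus_comm s k), HTp, (Rmult_comm k eps) by lra; apply H; lra.
Qed.

Context (F : E -> E) (W : E -> R) (p0 : E) (r L rate : R) (HL : 0 <= L)
  (HW : forall y z, norm (minus y p0) < r -> norm (minus z p0) < r ->
     W y - W z <= L * norm (minus y z))
  (Hrate : forall p, D p -> norm (minus p p0) < r ->
     dini_le (fun k => W (plus p (scal k (plus (A p) (F p))))) 0 rate).

Lemma growth_along_affine_path (K delta h e : R) (p c : E) :
  (forall t, 0 <= t <= delta -> opnorm (T t) <= K) -> 0 <= K ->
  0 <= h <= delta -> D p -> D c ->
  (forall s, 0 <= s <= h -> norm (minus (plus (T s p) (scal s c)) p0) < r) ->
  (forall s, 0 <= s <= h ->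
     norm (minus (minus c (scal s (A c))) (F (plus (T s p) (scal s c)))) <= e) ->
  W (plus (T h p) (scal h c)) <= W p + h * (rate + L * e).
Proof.
intros Hbound HK Hh Hp Hc Hball He.
set (v := fun s => plus (T s p) (scal s c)).
assert (v 0 = p) as Hv0.
{ unfold v; destruct HT as [HT0 _]; rewrite HT0; vec E. }
enough (W (v h) <= W (v 0) + (rate + L * e) * (h - 0)) as H
  by (rewrite Hv0 in H; unfold v in H; lra).
apply (dini_growth (fun s => W (v s)) 0 h (rate + L * e) 1); try lra.
- intros t Ht eps Heps.
  assert (0 < eps / (L + 1)) as He1 by (apply Rdiv_lt_0_compat; lra).
  destruct (semigroup_near_0 T HT p (eps / (L + 1) / (2 * (K + 1)))) as [eta [Heta Hx]];
    [apply Rdiv_lt_0_compat; lra|].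
  pose proof (norm_ge_0 c) as Hc0.
  assert (0 < eps / (L + 1) / (2 * (norm c + 1))) as He2 by (apply Rdiv_lt_0_compat; lra).
  exists (Rmin eta (eps / (L + 1) / (2 * (norm c + 1)))).
  split; [apply Rmin_pos; assumption|]; intros s Hs Hst.
  pose proof (Rmin_l eta (eps / (L + 1) / (2 * (norm c + 1)))).
  pose proof (Rmin_r eta (eps / (L + 1) / (2 * (norm c + 1)))).
  pose proof (HW (v t) (v s) (Hball t ltac:(lra)) (Hball s ltac:(lra))) as H1.
  assert (norm (minus (v t) (v s)) <= eps / (L + 1)) as H2.
  { unfold v; norm_as E (plus (minus (T t p) (T s p)) (scal (t - s) c)).
    apply Rle_trans with (1 := norm_triangle (V := E) _ _).
    replace (eps / (L + 1)) with ((K + 1) * (eps / (L + 1) / (2 * (K + 1)))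
      + eps / (L + 1) / (2 * (norm c + 1)) * (norm c + 1)) by (field; lra).
    apply Rplus_le_compat.
    - apply Rle_trans with (1 := semigroup_continuous_le T HT K delta Hbound s t p
        ltac:(lra) ltac:(lra)).
      apply Rmult_le_compat; [lra|apply norm_ge_0|lra|].
      apply Rlt_le, Hx; rewrite Rabs_pos_eq; lra.
    - apply Rle_trans with (1 := norm_scal_le (E := E) _ _); rewrite Rabs_pos_eq by lra.
      apply Rmult_le_compat; lra. }
  apply (Rmult_le_compat_l L) in H2; [|exact HL].
  assert (L * (eps / (L + 1)) <= (L + 1) * (eps / (L + 1))) as H3
    by (apply Rmult_le_compat_r; lra).
  replace ((L + 1) * (eps / (L + 1))) with eps in H3 by (field; lra).
  lra.
- intros t Ht _ eps Heps.
  destruct (affine_path_right_derivative p c t (proj1 Ht) Hp Hc) as [Hvt Hder].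
  fold (v t) in Hvt, Hder.
  assert (norm (minus (v t) p0) < r) as Hvr by (apply Hball; lra).
  assert (norm (minus (minus c (scal t (A c))) (F (v t))) <= e) as Het by (apply He; lra).
  destruct (Hrate (v t) Hvt Hvr (eps / 2) ltac:(lra)) as [e1 [He1 H1]].
  destruct (Hder (eps / (2 * (L + 1)))) as [e2 [He2 H2]];
    [apply Rdiv_lt_0_compat; lra|].
  set (d := plus (A (v t)) (F (v t))) in *.
  pose proof (norm_ge_0 d) as Hd.
  set (gap := r - norm (minus (v t) p0)).
  assert (0 < gap / (norm d + 1)) as Hgap
    by (apply Rdiv_lt_0_compat; unfold gap; lra).
  exists (Rmin (Rmin e1 e2) (Rmin (h - t) (gap / (norm d + 1) / 2))).
  split; [repeat apply Rmin_pos; lra|]; intros k Hk.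
  pose proof (Rmin_l (Rmin e1 e2) (Rmin (h - t) (gap / (norm d + 1) / 2))) as G1.
  pose proof (Rmin_r (Rmin e1 e2) (Rmin (h - t) (gap / (norm d + 1) / 2))) as G2.
  pose proof (Rmin_l e1 e2); pose proof (Rmin_r e1 e2).
  pose proof (Rmin_l (h - t) (gap / (norm d + 1) / 2)).
  pose proof (Rmin_r (h - t) (gap / (norm d + 1) / 2)).
  specialize (H1 k ltac:(lra)); specialize (H2 k ltac:(lra)).
  rewrite Rplus_0_l in H1.
  replace (plus (v t) (scal 0 d)) with (v t) in H1 by (vec E).
  assert (norm (minus (plus (v t) (scal k d)) p0) < r) as Hin.
  { norm_as E (plus (minus (v t) p0) (scal k d)).
    apply Rle_lt_trans with (1 := norm_triangle (V := E) _ _).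
    pose proof (norm_scal_le k d) as Hkd; rewrite Rabs_pos_eq in Hkd by lra.
    assert (k * norm d <= gap / (norm d + 1) / 2 * (norm d + 1)) as Hkd'
      by (apply Rmult_le_compat; lra).
    replace (gap / (norm d + 1) / 2 * (norm d + 1)) with (gap / 2) in Hkd' by (field; lra).
    unfold gap in *; lra. }
  pose proof (HW (v (t + k)) (plus (v t) (scal k d)) (Hball (t + k) ltac:(lra)) Hin) as HWk.
  assert (norm (minus (v (t + k)) (plus (v t) (scal k d)))
    <= k * (eps / (2 * (L + 1))) + k * e) as Hdist.
  { unfold d; norm_as E (plus (minus (minus (v (t + k)) (v t))
        (scal k (plus (A (v t)) (minus c (scal t (A c))))))
      (scal k (minus (minus c (scal t (A c))) (F (v t))))).
    apply Rle_trans with (1 := norm_triangle (V := E) _ _).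
    apply Rplus_le_compat; [exact H2|].
    apply Rle_trans with (1 := norm_scal_le (E := E) _ _); rewrite Rabs_pos_eq by lra.
    apply Rmult_le_compat_l; [lra|exact Het]. }
  apply (Rmult_le_compat_l L) in Hdist; [|exact HL].
  assert (L * (k * (eps / (2 * (L + 1)))) <= k * (eps / 2)) as HLeps.
  { replace (k * (eps / 2)) with ((L + 1) * (k * (eps / (2 * (L + 1))))) by (field; lra).
    apply Rmult_le_compat_r; [|lra].
    apply Rmult_le_pos; [lra|]; apply Rlt_le, Rdiv_lt_0_compat; lra. }
  lra.
Qed.

(** After a short time [h], a mild solution passing through [p0] differs by a small multiple
    of [h] from the affine path with [p = p0] and [c] close to [F p0], itself a limit of
    affine paths starting in the domain.  Hence the estimate of the rate, known only on the
    domain, bounds the Dini derivative of [W] along the mild solution, which need not be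
    differentiable. *)
Lemma dini_along_mild (w : R -> E) (t0 : R) :
  0 < r -> 0 <= t0 -> w t0 = p0 -> continuous F p0 ->
  continuous_on (fun t => 0 <= t) w ->
  (forall t, 0 <= t ->
     is_RInt (fun s => T (t - s) (F (w s))) 0 t (minus (w t) (T t (w 0)))) ->
  dini_le (fun t => W (w t)) t0 rate.
Proof.
intros Hr Ht0 Hwp HF Hw Hmild eps Heps.
destruct (semigroup_bounded_near_0 T HT HE) as [K [delta [Hdelta [HK Hbound]]]].
set (e := eps / (L * (2 * K + 4) + 1)).
assert (0 <= L * (2 * K + 4)) as HLK by (apply Rmult_le_pos; lra).
assert (0 < e) as He by (apply Rdiv_lt_0_compat; lra).
assert (e * (L * (2 * K + 4)) <= eps) as Heeps.
{ apply Rle_trans with (e * (L * (2 * K + 4) + 1)); [nra|right; unfold e; field; lra]. }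
destruct (proj1 (continuous_norm_iff F p0) HF e He) as [r0 [Hr0 HF0]].
set (r1 := Rmin r r0).
assert (0 < r1) as Hr1 by (apply Rmin_pos; assumption).
assert (r1 <= r) as Hr1r by apply Rmin_l.
assert (r1 <= r0) as Hr1r0 by apply Rmin_r.
destruct (HD (F p0) e He) as [c [Hc HcF]].
destruct (semigroup_near_0 T HT p0 (r1 / 4)) as [h1 [Hh1 Hp0]]; [lra|].
destruct (semigroup_near_0 T HT c e He) as [h2 [Hh2 HTc]].
destruct (proj1 (continuous_on_nonneg_iff w) Hw t0 Ht0 r1 Hr1) as [h3 [Hh3 Hwt]].
pose proof (norm_ge_0 c) as Hc0; pose proof (norm_ge_0 (A c)) as HAc0.
assert (0 < r1 / (4 * (norm c + 1))) as Hh4 by (apply Rdiv_lt_0_compat; lra).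
assert (0 < e / (norm (A c) + 1)) as Hh5 by (apply Rdiv_lt_0_compat; lra).
set (eta := Rmin (Rmin delta (Rmin h1 h2))
  (Rmin h3 (Rmin (r1 / (4 * (norm c + 1))) (e / (norm (A c) + 1)))) / 2).
assert (0 < 2 * eta) as Heta
  by (unfold eta; match goal with |- 0 < 2 * (?a / 2) => replace (2 * (a / 2)) with a by field
      end; repeat apply Rmin_pos; lra).
assert (2 * eta <= delta /\ 2 * eta <= h1 /\ 2 * eta <= h2 /\ 2 * eta <= h3 /\
  2 * eta <= r1 / (4 * (norm c + 1)) /\ 2 * eta <= e / (norm (A c) + 1))
  as [B1 [B2 [B3 [B4 [B5 B6]]]]].
{ unfold eta; match goal with |- context [2 * (?a / 2)] =>
    replace (2 * (a / 2)) with a by field end.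
  unfold Rmin; repeat destruct Rle_dec; repeat split; lra. }
clearbody eta.
exists eta; split; [lra|]; intros h Hh.
(* the radius [r1 / (4 K)] leaves room for the growth of the semigroup *)
assert (forall p s, norm (minus p p0) < r1 / (4 * K) -> 0 <= s <= h ->
  norm (minus (plus (T s p) (scal s c)) p0) < r1) as Hpath.
{ intros p s Hp Hs.
  norm_as E (plus (minus (T s p) (T s p0)) (plus (minus (T s p0) p0) (scal s c))).
  apply Rle_lt_trans with (K * norm (minus p p0) + (r1 / 4 + s * norm c)).
  { repeat apply (norm_plus_bound (E := E)).
    - rewrite <- (linear_minus _ _ _ (Lop_linear (T s))).
      apply (semigroup_norm_le T K delta Hbound); lra.
    - apply Rlt_le, Hp0; lra.
    - apply Rle_trans with (1 := norm_scal_le s c); rewrite Rabs_pos_eq; lra. }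
  assert (s * norm c <= r1 / (4 * (norm c + 1)) * (norm c + 1)) as H4
    by (apply Rmult_le_compat; lra).
  replace (r1 / (4 * (norm c + 1)) * (norm c + 1)) with (r1 / 4) in H4 by (field; lra).
  apply (Rmult_lt_compat_l K) in Hp; [|lra].
  replace (K * (r1 / (4 * K))) with (r1 / 4) in Hp by (field; lra).
  lra. }
assert (0 < r1 / (4 * K)) as HrK by (apply Rdiv_lt_0_compat; lra).
(* the forcing [c - s (A c)] of the path is within [3 e] of [F]: the errors come from [c],
   from [s (A c)] and from the variation of [F] *)
assert (forall p, D p -> norm (minus p p0) < r1 / (4 * K) ->
  W (plus (T h p) (scal h c)) <= W p + h * (rate + L * (3 * e))) as Hclass.
{ intros p HDp Hp.
  apply (growth_along_affine_path K delta h (3 * e) p c Hbound); try assumption; try lra.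
  - intros s Hs; apply Rlt_le_trans with (2 := Hr1r); apply Hpath; assumption.
  - intros s Hs.
    norm_as E (plus (minus c (F p0)) (plus (opp (scal s (A c)))
      (minus (F p0) (F (plus (T s p) (scal s c)))))).
    replace (3 * e) with (e + (e + e)) by ring.
    repeat apply (norm_plus_bound (E := E)).
    - apply Rlt_le, HcF.
    - apply Rle_trans with (norm (scal s (A c))); [right; exact (norm_opp (scal s (A c)))|].
      apply Rle_trans with (1 := norm_scal_le s (A c)).
      rewrite Rabs_pos_eq by lra.
      replace e with (e / (norm (A c) + 1) * (norm (A c) + 1)) by (field; lra).
      apply Rmult_le_compat; lra.
    - rewrite norm_minus_sym; apply Rlt_le, HF0.
      apply Rlt_le_trans with (2 := Hr1r0); apply Hpath; assumption. }
(* both sides depend continuously on the initial point, and the domain is dense *)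
assert (norm (minus p0 p0) < r1 / (4 * K)) as Hp00 by (rewrite norm_minus_diag; exact HrK).
assert (W (plus (T h p0) (scal h c)) <= W p0 + h * (rate + L * (3 * e))) as Haffine.
{ apply Rnot_lt_le; intros Hlt.
  set (d := W (plus (T h p0) (scal h c)) - (W p0 + h * (rate + L * (3 * e)))) in *.
  assert (0 < d) as Hd by (unfold d; lra).
  assert (0 <= L * (K + 1)) as HLK1 by (apply Rmult_le_pos; lra).
  assert (0 < d / (2 * (L * (K + 1) + 1))) as Hd2 by (apply Rdiv_lt_0_compat; lra).
  destruct (HD p0 (Rmin (Rmin r (r1 / (4 * K))) (d / (2 * (L * (K + 1) + 1)))))
    as [p [HDp Hp]]; [repeat apply Rmin_pos; lra|].
  pose proof (Rmin_l (Rmin r (r1 / (4 * K))) (d / (2 * (L * (K + 1) + 1)))).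
  pose proof (Rmin_r (Rmin r (r1 / (4 * K))) (d / (2 * (L * (K + 1) + 1)))).
  pose proof (Rmin_l r (r1 / (4 * K))); pose proof (Rmin_r r (r1 / (4 * K))).
  assert (norm (minus p p0) < r1 / (4 * K)) as HpK by lra.
  pose proof (Hclass p HDp HpK) as H3.
  pose proof (HW (plus (T h p0) (scal h c)) (plus (T h p) (scal h c))
    (Rlt_le_trans _ _ _ (Hpath p0 h Hp00 ltac:(lra)) Hr1r)
    (Rlt_le_trans _ _ _ (Hpath p h HpK ltac:(lra)) Hr1r)) as H4.
  replace (minus (plus (T h p0) (scal h c)) (plus (T h p) (scal h c)))
    with (T h (minus p0 p)) in H4
    by (rewrite (linear_minus _ _ _ (Lop_linear (T h))); vec E).
  pose proof (semigroup_norm_le T K delta Hbound h (minus p0 p) ltac:(lra)) as H5.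
  pose proof (HW p p0 ltac:(lra) ltac:(rewrite norm_minus_diag; lra)) as H6.
  rewrite (norm_minus_sym p0 p) in H5.
  apply (Rmult_le_compat_l L) in H5; [|exact HL].
  pose proof (norm_ge_0 (minus p p0)) as H7.
  assert ((L * (K + 1) + 1) * norm (minus p p0) < d) as H8.
  { apply Rle_lt_trans with ((L * (K + 1) + 1) * (d / (2 * (L * (K + 1) + 1)))).
    - apply Rmult_le_compat_l; lra.
    - replace ((L * (K + 1) + 1) * (d / (2 * (L * (K + 1) + 1)))) with (d / 2)
        by (field; lra); lra. }
  unfold d in H8; lra. }
(* the integrand of the mild formula stays within [(2 K + 1) e] of [c] *)
assert (norm (minus (w (t0 + h)) (plus (T h p0) (scal h c))) <= h * ((2 * K + 1) * e))
  as Hclose.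
{ pose proof (mild_restart T HT F w Hmild t0 h Ht0 (proj1 Hh)) as HI.
  rewrite Hwp in HI.
  norm_as E (minus (minus (w (t0 + h)) (T h p0)) (scal (t0 + h - t0) c)).
  replace (h * ((2 * K + 1) * e)) with ((t0 + h - t0) * ((2 * K + 1) * e)) by ring.
  apply (norm_RInt_le_const (fun s => minus (T (t0 + h - s) (F (w s))) c) t0 (t0 + h));
    [lra| |apply is_RInt_minus; [exact HI|apply is_RInt_const]].
  intros s Hs.
  set (S := T (t0 + h - s)).
  norm_as E (plus (minus (S (F (w s))) (S (F p0)))
    (plus (minus (S (F p0)) (S c)) (minus (S c) c))).
  rewrite <- !(linear_minus _ _ _ (Lop_linear S)).
  replace ((2 * K + 1) * e) with (K * e + (K * e + e)) by ring.
  assert (forall y, norm y < e -> norm (S y) <= K * e) as HS.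
  { intros y Hy.
    apply Rle_trans with (1 := semigroup_norm_le T K delta Hbound (t0 + h - s) y ltac:(lra)).
    apply Rmult_le_compat_l; lra. }
  repeat apply (norm_plus_bound (E := E)).
  - apply HS, HF0; rewrite <- Hwp; apply Rlt_le_trans with (2 := Hr1r0), Hwt; [lra|].
    rewrite Rabs_pos_eq; lra.
  - apply HS; rewrite norm_minus_sym; exact HcF.
  - apply Rlt_le, HTc; lra. }
assert (norm (minus (w (t0 + h)) p0) < r) as Hwr.
{ rewrite <- Hwp; apply Rlt_le_trans with (2 := Hr1r), Hwt; [lra|].
  rewrite Rabs_pos_eq; lra. }
pose proof (HW (w (t0 + h)) (plus (T h p0) (scal h c)) Hwr
  (Rlt_le_trans _ _ _ (Hpath p0 h Hp00 ltac:(lra)) Hr1r)) as H1.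
apply (Rmult_le_compat_l L) in Hclose; [|exact HL].
assert (h * (e * (L * (2 * K + 4))) <= h * eps) as H2 by (apply Rmult_le_compat_l; lra).
rewrite Hwp; lra.
Qed.

End MildSolutions.

(** * Calculus of Dini bounds *)

Lemma dini_le_weaken (phi : R -> R) (t c d : R) : c <= d -> dini_le phi t c -> dini_le phi t d.
Proof.
intros Hcd H eps Heps; destruct (H eps Heps) as [eta [Heta H']].
exists eta; split; [exact Heta|]; intros k Hk; specialize (H' k Hk); nra.
Qed.

Lemma dini_le_limit (phi : R -> R) (t c : R) :
  (forall eps, 0 < eps -> dini_le phi t (c + eps)) -> dini_le phi t c.
Proof.
intros H eps Heps; destruct (H (eps / 2) ltac:(lra) (eps / 2) ltac:(lra)) as [eta [Heta H']].
exists eta; split; [exact Heta|]; intros k Hk; specialize (H' k Hk).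
replace (c + eps) with (c + eps / 2 + eps / 2) by field; exact H'.
Qed.

Lemma dini_le_plus (phi psi : R -> R) (t c d : R) :
  dini_le phi t c -> dini_le psi t d -> dini_le (fun s => phi s + psi s) t (c + d).
Proof.
intros H1 H2 eps Heps.
destruct (H1 (eps / 2) ltac:(lra)) as [e1 [He1 H1']].
destruct (H2 (eps / 2) ltac:(lra)) as [e2 [He2 H2']].
exists (Rmin e1 e2); split; [apply Rmin_pos; assumption|]; intros k Hk.
pose proof (Rmin_l e1 e2); pose proof (Rmin_r e1 e2).
pose proof (H1' k ltac:(lra)); pose proof (H2' k ltac:(lra)); lra.
Qed.

Lemma dini_le_scal (phi : R -> R) (t c a : R) :
  0 < a -> dini_le phi t c -> dini_le (fun s => a * phi s) t (a * c).
Proof.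
intros Ha H eps Heps.
destruct (H (eps / a)) as [eta [Heta H']]; [apply Rdiv_lt_0_compat; lra|].
exists eta; split; [exact Heta|]; intros k Hk; specialize (H' k Hk).
apply (Rmult_le_compat_l a) in H'; [|lra].
replace (a * (phi t + k * (c + eps / a))) with (a * phi t + k * (a * c + eps)) in H'
  by (field; lra).
exact H'.
Qed.

Lemma dini_le_norm2 {H : HilbertSpace} (e : R -> H) (v : H) :
  (forall eps, 0 < eps -> exists eta, 0 < eta /\ forall k, 0 <= k <= eta ->
     norm (minus (minus (e k) (e 0)) (scal k v) : H) <= k * eps) ->
  dini_le (fun k => norm (e k) ^ 2) 0 (2 * inner (e 0) v).
Proof.
intros He eps Heps.
assert (0 <= norm (e 0)) as Ha by apply norm_ge_0.
assert (0 <= norm v) as Hv by apply norm_ge_0.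
set (a := norm (e 0)) in *; set (b := norm v) in *.
assert (0 < eps / (4 * (a + 1))) as He1 by (apply Rdiv_lt_0_compat; lra).
set (e1 := eps / (4 * (a + 1))) in *.
assert (a * e1 <= eps / 4) as Hae1.
{ apply Rle_trans with ((a + 1) * e1); [nra|right; unfold e1; field; lra]. }
destruct (He e1 He1) as [eta [Heta Hexp]].
assert (0 < 2 * (b + e1) ^ 2 + 1) as Hden by (pose proof (pow2_ge_0 (b + e1)); lra).
assert (0 < eps / (2 * (b + e1) ^ 2 + 1)) as He2 by (apply Rdiv_lt_0_compat; lra).
exists (Rmin eta (eps / (2 * (b + e1) ^ 2 + 1))).
split; [apply Rmin_pos; assumption|]; intros k Hk.
pose proof (Rmin_l eta (eps / (2 * (b + e1) ^ 2 + 1))).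
pose proof (Rmin_r eta (eps / (2 * (b + e1) ^ 2 + 1))).
rewrite Rplus_0_l.
set (q := minus (minus (e k) (e 0)) (scal k v) : H).
assert (norm q <= k * e1) as Hq by (apply Hexp; lra).
assert (e k = plus (e 0) (plus (scal k v) q) :> H) as ->
  by (unfold q; vec (CompleteNormedModule.NormedModule R_AbsRing H)).
set (d := plus (scal k v) q : H).
rewrite (norm2_plus (e 0) d); fold a.
assert (inner (e 0) d = k * inner (e 0) v + inner (e 0) q) as ->
  by (transitivity (inner (e 0) (scal k v) + inner (e 0) q);
      [apply inner_plus_r|f_equal; apply inner_scal_r]).
pose proof (Rle_trans _ _ _ (Rle_abs _) (cauchy_schwarz (e 0) q)) as Hcs; fold a in Hcs.
assert (norm d <= k * b + k * e1) as Hd.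
{ apply (norm_plus_bound (E := H)); [|exact Hq].
  apply Rle_trans with (1 := norm_scal_le (E := H) k v); rewrite Rabs_pos_eq; [|lra].
  apply Rle_refl. }
assert (0 <= norm d) as Hd0 by apply norm_ge_0.
assert (norm d ^ 2 <= (k * (b + e1)) ^ 2) as Hd2 by (apply pow_incr; lra).
assert (k * (b + e1) ^ 2 <= eps / 2) as Hk2.
{ apply Rle_trans with (eps / (2 * (b + e1) ^ 2 + 1) * ((2 * (b + e1) ^ 2 + 1) / 2)).
  - apply Rmult_le_compat; try lra; apply pow2_ge_0.
  - right; field; lra. }
assert (a * norm q <= k * (eps / 4)) as Haq.
{ apply Rle_trans with (a * (k * e1)); [apply Rmult_le_compat_l; lra|].
  replace (a * (k * e1)) with (k * (a * e1)) by ring; apply Rmult_le_compat_l; lra. }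
assert (k * (k * (b + e1) ^ 2) <= k * (eps / 2)) by (apply Rmult_le_compat_l; lra).
lra.
Qed.

(** This rests on [exp (omega * k) * (1 - omega * k) <= 1]. *)
Lemma dini_le_exp (phi : R -> R) (t omega : R) :
  0 <= omega -> 0 <= phi t -> dini_le phi t (- omega * phi t) ->
  dini_le (fun s => exp (omega * s) * phi s) t 0.
Proof.
intros Ho Hphi H eps Heps.
pose proof (exp_pos (omega * (t + 1))) as Hexp.
destruct (H (eps / exp (omega * (t + 1)))) as [eta [Heta H']];
  [apply Rdiv_lt_0_compat; lra|].
exists (Rmin eta 1); split; [apply Rmin_pos; lra|]; intros k Hk.
pose proof (Rmin_l eta 1); pose proof (Rmin_r eta 1).
specialize (H' k ltac:(lra)); pose proof (exp_pos (omega * t)).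
apply (Rmult_le_compat_l (exp (omega * (t + k)))) in H'; [|apply Rlt_le, exp_pos].
apply Rle_trans with (1 := H').
replace (exp (omega * (t + k)) *
    (phi t + k * (- omega * phi t + eps / exp (omega * (t + 1)))))
  with (exp (omega * t) * phi t * (exp (omega * k) * (1 + - (omega * k)))
    + exp (omega * (t + k)) * (k * (eps / exp (omega * (t + 1)))))
  by (replace (exp (omega * (t + k))) with (exp (omega * t) * exp (omega * k))
        by (rewrite <- exp_plus; f_equal; ring); field; lra).
assert (exp (omega * k) * (1 + - (omega * k)) <= 1) as Hfac.
{ replace 1 with (exp (omega * k) * exp (- (omega * k))) at 2
    by (rewrite <- exp_plus, Rplus_opp_r; apply exp_0).
  apply Rmult_le_compat_l; [apply Rlt_le, exp_pos|apply exp_ineq1_le]. }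
assert (exp (omega * (t + k)) * (k * (eps / exp (omega * (t + 1)))) <= k * eps) as Herr.
{ apply Rle_trans with (exp (omega * (t + 1)) * (k * (eps / exp (omega * (t + 1)))));
    [|right; field; lra].
  apply Rmult_le_compat_r.
  - apply Rmult_le_pos; [lra|apply Rlt_le, Rdiv_lt_0_compat; lra].
  - destruct (Req_dec (omega * (t + k)) (omega * (t + 1))) as [->|Hne]; [lra|].
    apply Rlt_le, exp_increasing; nra. }
apply (Rmult_le_compat_l (exp (omega * t) * phi t)) in Hfac; [|apply Rmult_le_pos; lra].
lra.
Qed.

(** The sublevel set [phi < b] is never left, because the decay holds inside it. *)
Lemma exponential_decay_in_sublevel (phi : R -> R) (omega b : R) :
  0 < omega -> (forall t, 0 <= t -> 0 <= phi t) -> phi 0 < b ->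
  (forall t, 0 < t -> forall eps, 0 < eps -> exists eta, 0 < eta /\
     forall s, 0 <= s <= t -> t - eta < s -> phi t <= phi s + eps) ->
  (forall t, 0 <= t -> phi t < b -> dini_le phi t (- omega * phi t)) ->
  forall t, 0 <= t -> exp (omega * t) * phi t <= phi 0 /\ phi t < b.
Proof.
intros Ho Hpos H0 Hjump Hdini t Ht.
assert (forall s, 0 <= s -> phi s <= exp (omega * s) * phi s) as Hle.
{ intros s Hs; pose proof (exp_ineq1_le (omega * s)); pose proof (Hpos s Hs).
  assert (0 <= omega * s) by (apply Rmult_le_pos; lra); nra. }
assert (exp (omega * t) * phi t <= exp (omega * 0) * phi 0 + 0 * (t - 0)) as H.
{ apply (dini_growth (fun s => exp (omega * s) * phi s) 0 t 0 ((b - phi 0) / (2 * (t + 1)))).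
  - exact Ht.
  - apply Rdiv_lt_0_compat; lra.
  - intros s Hs eps Heps.
    pose proof (exp_pos (omega * s)) as Hexp; pose proof (Hpos s ltac:(lra)) as Hps.
    destruct (Hjump s ltac:(lra) (eps / (2 * exp (omega * s)))) as [eta [Heta H]];
      [apply Rdiv_lt_0_compat; lra|].
    set (m := exp (omega * s) * omega * phi s).
    assert (0 <= m) as Hm by (unfold m; repeat apply Rmult_le_pos; lra).
    assert (0 < eps / (2 * (m + 1))) as Hd by (apply Rdiv_lt_0_compat; lra).
    exists (Rmin eta (eps / (2 * (m + 1)))); split; [apply Rmin_pos; assumption|].
    intros r Hr Hsr.
    pose proof (Rmin_l eta (eps / (2 * (m + 1)))); pose proof (Rmin_r eta (eps / (2 * (m + 1)))).
    specialize (H r Hr ltac:(lra)).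
    pose proof (exp_ineq1_le (- (omega * (s - r)))) as G1.
    replace (exp (omega * r)) with (exp (omega * s) * exp (- (omega * (s - r))))
      by (rewrite <- exp_plus; f_equal; ring).
    assert (exp (- (omega * (s - r))) <= 1) as G2.
    { rewrite <- exp_0; destruct (Req_dec r s) as [->|Hne].
      - right; f_equal; ring.
      - apply Rlt_le, exp_increasing; nra. }
    pose proof (exp_pos (- (omega * (s - r)))) as G3.
    assert (m * (s - r) <= eps / 2) as G4.
    { apply Rle_trans with ((m + 1) * (eps / (2 * (m + 1)))); [|right; field; lra].
      apply Rmult_le_compat; lra. }
    set (x := exp (- (omega * (s - r)))) in *.
    assert (x * (phi s - phi r) <= eps / (2 * exp (omega * s))) as G5.
    { assert (0 < eps / (2 * exp (omega * s))) by (apply Rdiv_lt_0_compat; lra); nra. }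
    assert ((1 - x) * phi s <= omega * (s - r) * phi s) as G6
      by (apply Rmult_le_compat_r; lra).
    assert (phi s - x * phi r <= eps / (2 * exp (omega * s)) + omega * (s - r) * phi s) as G7
      by lra.
    apply (Rmult_le_compat_l (exp (omega * s))) in G7; [|lra].
    replace (exp (omega * s) * (eps / (2 * exp (omega * s)) + omega * (s - r) * phi s))
      with (eps / 2 + m * (s - r)) in G7 by (unfold m; field; lra).
    lra.
  - intros s Hs Hline; rewrite Rmult_0_r, exp_0, Rmult_1_l in Hline.
    apply dini_le_exp; [lra|apply Hpos; lra|]; apply Hdini; [lra|].
    apply Rle_lt_trans with (1 := Hle s (proj1 Hs)).
    apply Rle_lt_trans with (1 := Hline).
    assert ((b - phi 0) / (2 * (t + 1)) * (s - 0) <= (b - phi 0) / (2 * (t + 1)) * (t + 1))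
      as H1 by (apply Rmult_le_compat_l; [apply Rlt_le, Rdiv_lt_0_compat|]; lra).
    replace ((b - phi 0) / (2 * (t + 1)) * (t + 1)) with ((b - phi 0) / 2) in H1
      by (field; lra).
    lra. }
rewrite Rmult_0_r, exp_0, Rmult_1_l in H.
split; [lra|]; pose proof (Hle t Ht); lra.
Qed.

(** On a small ball the rate [- omega * W p] is constant up to [eps] because [W] is
    Lipschitz there, so that [dini_along_mild] applies with a constant rate. *)
Lemma decay_along_mild {E : NormedModule R_AbsRing} (T : R -> Lop E E) (D : E -> Prop)
  (A F : E -> E) (W : E -> R) (w : R -> E) (omega t : R) (G : E -> Prop) :
  C0_semigroup T -> infinitesimal_generator T D A -> sequentially_complete E ->
  (forall x eps, 0 < eps -> exists y, D y /\ norm (minus y x) < eps) ->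
  continuous F (w t) -> 0 <= omega -> 0 <= t ->
  (exists r L, 0 < r /\ 0 <= L /\ forall y z, norm (minus y (w t)) < r ->
     norm (minus z (w t)) < r -> W y - W z <= L * norm (minus y z)) ->
  locally (w t) G ->
  (forall p, D p -> G p ->
     dini_le (fun k => W (plus p (scal k (plus (A p) (F p))))) 0 (- omega * W p)) ->
  continuous_on (fun s => 0 <= s) w ->
  (forall s, 0 <= s ->
     is_RInt (fun q => T (s - q) (F (w q))) 0 s (minus (w s) (T s (w 0)))) ->
  dini_le (fun s => W (w s)) t (- omega * W (w t)).
Proof.
intros HT HA HE HD HF Ho Ht [r [L [Hr [HL HW]]]] HG Hrate Hw Hmild.
apply locally_norm_iff in HG; destruct HG as [rG [HrG HG]].
apply dini_le_limit; intros eps Heps.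
assert (0 <= omega * L) as HoL by (apply Rmult_le_pos; assumption).
assert (0 < eps / (omega * L + 1)) as He by (apply Rdiv_lt_0_compat; lra).
set (r' := Rmin (Rmin r rG) (eps / (omega * L + 1))).
assert (0 < r') as Hr' by (repeat apply Rmin_pos; assumption).
assert (r' <= r) by (eapply Rle_trans; [apply Rmin_l|apply Rmin_l]).
assert (r' <= rG) by (eapply Rle_trans; [apply Rmin_l|apply Rmin_r]).
assert (r' <= eps / (omega * L + 1)) by apply Rmin_r.
apply (dini_along_mild T D A HT HA HE HD F W (w t) r' L _ HL); try assumption.
- intros y z Hy Hz; apply HW; lra.
- intros p Hp Hpr; apply dini_le_weaken with (- omega * W p); [|apply Hrate, HG; [exact Hp|lra]].
  pose proof (HW (w t) p ltac:(rewrite norm_minus_diag; exact Hr) ltac:(lra)) as H2.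
  rewrite norm_minus_sym in H2.
  apply (Rmult_le_compat_l omega) in H2; [|exact Ho].
  pose proof (norm_ge_0 (minus p (w t))) as H3.
  assert ((omega * L + 1) * norm (minus p (w t)) <= (omega * L + 1) * (eps / (omega * L + 1)))
    as H4 by (apply Rmult_le_compat_l; lra).
  replace ((omega * L + 1) * (eps / (omega * L + 1))) with eps in H4 by (field; lra).
  lra.
- reflexivity.
Qed.

(** * Continuity of the closed-loop vector field *)

Lemma continuous_bilinear {E0 E1 E2 E3 : NormedModule R_AbsRing} (b : E1 -> E2 -> E3)
  (u : E0 -> E1) (v : E0 -> E2) (x : E0) :
  (forall y y' z, b (minus y y') z = minus (b y z) (b y' z)) ->
  (forall y z z', b y (minus z z') = minus (b y z) (b y z')) ->
  (forall y z, norm (b y z) <= norm y * norm z) ->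
  continuous u x -> continuous v x -> continuous (fun t => b (u t) (v t)) x.
Proof.
intros Hbl Hbr Hb Hu Hv; apply continuous_norm_iff; intros eps Heps.
pose proof (norm_ge_0 (u x)); pose proof (norm_ge_0 (v x)).
assert (0 < eps / (2 * (norm (u x) + 1))) as H1 by (apply Rdiv_lt_0_compat; lra).
assert (0 < eps / (2 * (norm (v x) + 1))) as H2 by (apply Rdiv_lt_0_compat; lra).
destruct (proj1 (continuous_norm_iff u x) Hu _ H2) as [e1 [He1 Hu']].
destruct (proj1 (continuous_norm_iff v x) Hv _ (Rmin_pos _ _ Rlt_0_1 H1)) as [e2 [He2 Hv']].
exists (Rmin e1 e2); split; [apply Rmin_pos; assumption|]; intros t Ht.
pose proof (Hu' t (Rlt_le_trans _ _ _ Ht (Rmin_l _ _))) as Hut.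
pose proof (Hv' t (Rlt_le_trans _ _ _ Ht (Rmin_r _ _))) as Hvt.
pose proof (Rmin_l 1 (eps / (2 * (norm (u x) + 1)))).
pose proof (Rmin_r 1 (eps / (2 * (norm (u x) + 1)))).
norm_as E3 (plus (minus (b (u t) (v t)) (b (u x) (v t)))
  (minus (b (u x) (v t)) (b (u x) (v x)))).
rewrite <- Hbl, <- Hbr.
pose proof (norm_le_minus (v t) (v x)) as Hvn.
apply Rle_lt_trans with (norm (minus (u t) (u x)) * (norm (v x) + 1)
  + norm (u x) * (eps / (2 * (norm (u x) + 1)))).
{ apply (norm_plus_bound (E := E3)).
  - apply Rle_trans with (1 := Hb _ _); apply Rmult_le_compat_l; [apply norm_ge_0|lra].
  - apply Rle_trans with (1 := Hb _ _); apply Rmult_le_compat_l; lra. }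
apply Rlt_le_trans with (eps / (2 * (norm (v x) + 1)) * (norm (v x) + 1)
  + (norm (u x) + 1) * (eps / (2 * (norm (u x) + 1)))); [|right; field; lra].
apply Rplus_lt_le_compat.
- apply Rmult_lt_compat_r; lra.
- apply Rmult_le_compat_r; lra.
Qed.

Lemma continuous_Lop_apply {E0 E1 E2 : NormedModule R_AbsRing} (L : E0 -> Lop E1 E2)
  (u : E0 -> E1) (x : E0) :
  continuous L x -> continuous u x -> continuous (fun t => L t (u t)) x.
Proof.
apply (continuous_bilinear (fun (M : Lop E1 E2) y => M y)).
- reflexivity.
- intros M y z; apply (linear_minus _ _ _ (Lop_linear M)).
- intros M y; apply opnorm_bound.
Qed.

Lemma continuous_Lop_comp {E0 E1 E2 E3 : NormedModule R_AbsRing} (L : E0 -> Lop E2 E3)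
  (M : E0 -> Lop E1 E2) (x : E0) :
  continuous L x -> continuous M x -> continuous (fun t => Lop_comp (L t) (M t)) x.
Proof.
apply (continuous_bilinear (fun (P : Lop E2 E3) (Q : Lop E1 E2) => Lop_comp P Q)).
- intros P P' Q; apply Lop_ext; reflexivity.
- intros P Q Q'; apply Lop_ext; intros y; apply (linear_minus _ _ _ (Lop_linear P)).
- intros P Q; apply opnorm_comp.
Qed.

Lemma continuous_adjoint {E0 : NormedModule R_AbsRing} {H1 H2 : HilbertSpace}
  (L : E0 -> Lop H1 H2) (x : E0) :
  continuous L x -> continuous (fun t => adjoint (L t)) x.
Proof.
intros HL; apply (proj2 (continuous_norm_iff (fun t => adjoint (L t)) x)); intros eps Heps.
destruct (proj1 (continuous_norm_iff L x) HL eps Heps) as [eta [Heta H]].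
exists eta; split; [exact Heta|]; intros y Hy.
apply Rle_lt_trans with (2 := H y Hy).
apply (opnorm_le (minus (adjoint (L y)) (adjoint (L x)))); [apply norm_ge_0|].
intros z; apply norm_adjoint_minus_le.
Qed.

Lemma continuous_pair {E0 E1 E2 : NormedModule R_AbsRing} (u : E0 -> E1) (v : E0 -> E2)
  (x : E0) :
  continuous u x -> continuous v x ->
  continuous (fun t => (u t, v t) : prod_NormedModule R_AbsRing E1 E2) x.
Proof.
intros Hu Hv; apply continuous_norm_iff; intros eps Heps.
destruct (proj1 (continuous_norm_iff u x) Hu (eps / 2) ltac:(lra)) as [e1 [He1 Hu']].
destruct (proj1 (continuous_norm_iff v x) Hv (eps / 2) ltac:(lra)) as [e2 [He2 Hv']].
exists (Rmin e1 e2); split; [apply Rmin_pos; assumption|]; intros t Ht.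
pose proof (Hu' t (Rlt_le_trans _ _ _ Ht (Rmin_l _ _))) as Hut.
pose proof (Hv' t (Rlt_le_trans _ _ _ Ht (Rmin_r _ _))) as Hvt.
apply Rle_lt_trans with (1 := norm_prod_le _).
replace eps with (eps / 2 + eps / 2) by field.
apply Rplus_lt_compat; [exact Hut|exact Hvt].
Qed.

Lemma closed_loop_nonlinearity_continuous {X U Y : HilbertSpace} (f : X -> X)
  (g : X -> Lop U X) (h : X -> Y) (S : Lop Y Y) (M : X -> Y) (dM : X -> Lop X Y) :
  (forall x, continuous f x) -> (forall x, continuous g x) -> (forall x, continuous h x) ->
  (forall x, continuous M x) -> (forall x, continuous dM x) ->
  forall p : prod_NormedModule R_AbsRing X Y,
    continuous (closed_loop_nonlinearity f g h S M dM :
      prod_NormedModule R_AbsRing X Y -> prod_NormedModule R_AbsRing X Y) p.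
Proof.
intros Hf Hg Hh HM HdM p.
set (XY := prod_NormedModule R_AbsRing X Y) in *.
assert (forall (E : NormedModule R_AbsRing) (k : X -> E), (forall x, continuous k x) ->
  continuous (fun q : XY => k (fst q)) p) as Hfst.
{ intros E k Hk; apply (continuous_comp (fun q : XY => fst q) k); [|apply Hk].
  apply continuous_fst. }
assert (continuous (fun q : XY => snd q) p) as Hsnd by apply continuous_snd.
apply continuous_ext with (fun q : XY =>
  (plus (f (fst q)) (g (fst q) (feedback g M dM (fst q) (snd q))),
   plus (S (snd q)) (h (fst q)))).
{ intros [x z]; reflexivity. }
apply (continuous_pair (E1 := X) (E2 := Y)).
- apply (continuous_plus (V := X)); [apply Hfst, Hf|].
  apply (continuous_Lop_apply (E1 := U) (E2 := X)); [apply Hfst, Hg|].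
  apply (continuous_Lop_apply (E1 := X) (E2 := U) (fun q : XY => adjoint (g (fst q)))).
  { apply continuous_adjoint, Hfst, Hg. }
  apply (continuous_Lop_apply (E1 := Y) (E2 := X) (fun q : XY => adjoint (dM (fst q)))).
  { apply continuous_adjoint, Hfst, HdM. }
  apply (continuous_minus (V := Y)); [exact Hsnd|apply Hfst, HM].
- apply (continuous_plus (V := Y)); [|apply Hfst, Hh].
  apply (continuous_comp (fun q : XY => snd q) S); [exact Hsnd|].
  apply (linear_cont S), Lop_linear.
Qed.

(** * The Lyapunov functional of the closed loop *)

Section ClosedLoop.
Context {X U Y : HilbertSpace}.
Local Notation XY := (prod_NormedModule R_AbsRing X Y).

Definition graph_lyapunov (V : X -> R) (M : X -> Y) (beta : R) (p : XY) : R :=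
  V (fst p) + beta * norm (minus (snd p) (M (fst p)) : Y) ^ 2.

Lemma graph_lyapunov_lipschitz (V : X -> R_NormedModule) (M : X -> Y) (beta : R) (p0 : XY) :
  0 <= beta -> lipschitz_near V (fst p0) -> lipschitz_near M (fst p0) ->
  exists r L, 0 < r /\ 0 <= L /\
    forall p q : XY, norm (minus p p0) < r -> norm (minus q p0) < r ->
      graph_lyapunov V M beta p - graph_lyapunov V M beta q <= L * norm (minus p q).
Proof.
intros Hbeta [r1 [k1 [Hr1 [Hk1 HV]]]] [r2 [k2 [Hr2 [Hk2 HM]]]].
set (e := fun p : XY => minus (snd p) (M (fst p)) : Y).
set (r := Rmin 1 (Rmin r1 r2)).
assert (0 < r) as Hr by (unfold r; repeat apply Rmin_pos; lra).
assert (r <= 1) as Hr1' by apply Rmin_l.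
assert (r <= r1) as Hrr1 by (eapply Rle_trans; [apply Rmin_r|apply Rmin_l]).
assert (r <= r2) as Hrr2 by (eapply Rle_trans; [apply Rmin_r|apply Rmin_r]).
assert (forall p q : XY, norm (minus (fst p) (fst q)) <= norm (minus p q)) as Hfst
  by (intros p q; exact (norm_fst_le (minus p q))).
assert (forall p q : XY, norm (minus (snd p) (snd q)) <= norm (minus p q)) as Hsnd
  by (intros p q; exact (norm_snd_le (minus p q))).
assert (forall p q : XY, norm (minus p p0) < r -> norm (minus q p0) < r ->
  norm (minus (e p) (e q) : Y) <= (1 + k2) * norm (minus p q)) as He.
{ intros p q Hp Hq; unfold e.
  norm_as (CompleteNormedModule.NormedModule R_AbsRing Y)
    (plus (minus (snd p) (snd q)) (opp (minus (M (fst p)) (M (fst q))))).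
  rewrite Rmult_plus_distr_r, Rmult_1_l.
  apply (norm_plus_bound (E := Y)); [apply Hsnd|].
  apply Rle_trans with (norm (minus (M (fst p)) (M (fst q)) : Y));
    [right; exact (norm_opp (minus (M (fst p)) (M (fst q)) : Y))|].
  apply Rle_trans with (k2 * norm (minus (fst p) (fst q) : X)).
  - apply HM.
    + apply Rle_lt_trans with (1 := Hfst p p0); lra.
    + apply Rle_lt_trans with (1 := Hfst q p0); lra.
  - apply Rmult_le_compat_l; [exact Hk2|apply Hfst]. }
set (b := norm (e p0) + (1 + k2)).
assert (0 <= norm (e p0)) as He0 by apply norm_ge_0.
assert (0 <= b) as Hb by (unfold b; lra).
assert (forall p : XY, norm (minus p p0) < r -> norm (e p) <= b) as Heb.
{ intros p Hp; apply Rle_trans with (1 := norm_le_minus (E := Y) (e p) (e p0)).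
  apply Rplus_le_compat_l.
  apply Rle_trans with (1 := He p p0 Hp ltac:(rewrite norm_minus_diag; exact Hr)).
  rewrite <- (Rmult_1_r (1 + k2)) at 2; apply Rmult_le_compat_l; lra. }
exists r, (k1 + beta * (2 * b * (1 + k2))); split; [exact Hr|]; split.
{ assert (0 <= beta * (2 * b * (1 + k2))) by (repeat apply Rmult_le_pos; lra); lra. }
intros p q Hp Hq.
assert (V (fst p) - V (fst q) <= k1 * norm (minus p q)) as HVpq.
{ apply Rle_trans with (1 := Rle_abs _).
  apply Rle_trans with (k1 * norm (minus (fst p) (fst q) : X)).
  - apply HV.
    + apply Rle_lt_trans with (1 := Hfst p p0); lra.
    + apply Rle_lt_trans with (1 := Hfst q p0); lra.
  - apply Rmult_le_compat_l; [exact Hk1|apply Hfst]. }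
assert (norm (e p) ^ 2 - norm (e q) ^ 2 <= 2 * b * (1 + k2) * norm (minus p q)) as Hepq.
{ pose proof (Heb p Hp) as H1; pose proof (Heb q Hq) as H2.
  assert (norm (e p) <= norm (e q) + (1 + k2) * norm (minus p q)) as H3.
  { apply Rle_trans with (1 := norm_le_minus (E := Y) (e p) (e q)).
    apply Rplus_le_compat_l, He; assumption. }
  assert (0 <= norm (e p)) as H4 by apply norm_ge_0.
  assert (0 <= norm (e q)) as H5 by apply norm_ge_0.
  assert (0 <= (1 + k2) * norm (minus p q)) as H6
    by (apply Rmult_le_pos; [lra|apply norm_ge_0]).
  set (d := (1 + k2) * norm (minus p q)) in *.
  replace (2 * b * (1 + k2) * norm (minus p q)) with (2 * b * d) by (unfold d; ring).
  nra. }
apply (Rmult_le_compat_l beta) in Hepq; [|exact Hbeta].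
unfold graph_lyapunov; fold (e p) (e q); lra.
Qed.

Lemma graph_lyapunov_dini (V : X -> R_NormedModule) (dV : X -> Lop X R_NormedModule)
  (M : X -> Y) (dM : X -> Lop X Y) (beta : R) (p d : XY) :
  0 < beta ->
  filterdiff V (locally (fst p)) (dV (fst p)) ->
  filterdiff M (locally (fst p)) (dM (fst p)) ->
  dini_le (fun k => graph_lyapunov V M beta (plus p (scal k d))) 0
    (dV (fst p) (fst d) + beta * (2 * inner (minus (snd p) (M (fst p)))
       (minus (snd d) (dM (fst p) (fst d))))).
Proof.
intros Hbeta HV HM.
set (x := fst p) in *; set (z := snd p); set (xi := fst d); set (zeta := snd d).
change (dini_le (fun k => V (plus x (scal k xi))
    + beta * norm (minus (plus z (scal k zeta)) (M (plus x (scal k xi))) : Y) ^ 2) 0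
  (dV x xi + beta * (2 * inner (minus z (M x)) (minus zeta (dM x xi))))).
assert (plus x (scal 0 xi) = x) as Hx0
  by (vec (CompleteNormedModule.NormedModule R_AbsRing X)).
assert (plus z (scal 0 zeta) = z) as Hz0
  by (vec (CompleteNormedModule.NormedModule R_AbsRing Y)).
apply dini_le_plus; [|apply dini_le_scal; [exact Hbeta|]].
- intros eps Heps.
  destruct (filterdiff_directional V (dV x) x xi HV eps Heps) as [eta [Heta H]].
  exists eta; split; [exact Heta|]; intros k Hk; specialize (H k Hk).
  rewrite Rplus_0_l, Hx0.
  apply (Rle_trans _ _ _ (Rle_abs _)) in H.
  change (V (plus x (scal k xi)) + - V x + - (k * dV x xi) <= k * eps) in H.
  lra.
- set (e := fun k : R => minus (plus z (scal k zeta)) (M (plus x (scal k xi))) : Y).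
  assert (e 0 = minus z (M x)) as He0 by (unfold e; rewrite Hx0, Hz0; reflexivity).
  rewrite <- He0; apply (dini_le_norm2 e).
  intros eps Heps.
  destruct (filterdiff_directional M (dM x) x xi HM eps Heps) as [eta [Heta H]].
  exists eta; split; [exact Heta|]; intros k Hk; specialize (H k Hk).
  rewrite He0; unfold e; apply Rle_trans with (2 := H); right.
  apply eq_trans with (2 := norm_opp (minus (minus (M (plus x (scal k xi))) (M x))
    (scal k (dM x xi)) : Y)).
  f_equal; vec (CompleteNormedModule.NormedModule R_AbsRing Y).
Qed.

Context (DA : X -> Prop) (A f : X -> X) (g : X -> Lop U X) (C h : X -> Y) (S : Lop Y Y)
  (M : X -> Y) (dM : X -> Lop X Y).

Lemma skew_adjoint_inner (y : Y) : adjoint S = opp S -> inner y (S y) = 0.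
Proof.
intros HS.
pose proof (adjointP S y y) as H; rewrite HS in H.
change (inner (S y) y = inner y (opp (S y))) in H.
assert (inner y (opp (S y)) = Ropp 1 * inner y (S y)) as H1.
{ transitivity (inner y (scal (Ropp 1) (S y))); [f_equal; exact (opp_scal (S y))|].
  apply inner_scal_r. }
rewrite H1, inner_sym in H; lra.
Qed.

(** Along the flow, [e = z - M x] satisfies [e' = S e - dM(x) g(x) u]: the invariance of
    the graph of [M] cancels all the terms of the open loop. *)
Lemma graph_error_dissipation (x : X) (z : Y) :
  adjoint S = opp S -> invariant_graph DA A f C h S M dM -> DA x ->
  let u := feedback g M dM x z in
  inner (minus z (M x))
    (minus (plus (C x) (plus (S z) (h x))) (dM x (plus (A x) (plus (f x) (g x u)))))
  = - norm u ^ 2.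
Proof.
intros HS [_ [_ [_ Hinv]]] Hx u.
set (e := minus z (M x) : Y).
assert (minus (plus (C x) (plus (S z) (h x))) (dM x (plus (A x) (plus (f x) (g x u))))
  = minus (S e) (dM x (g x u)) :> Y) as ->.
{ assert (dM x (plus (A x) (plus (f x) (g x u)))
    = plus (plus (plus (S (M x)) (C x)) (h x)) (dM x (g x u))) as ->.
  { rewrite <- (Hinv x Hx).
    transitivity (dM x (plus (plus (A x) (f x)) (g x u))); [f_equal; apply plus_assoc|].
    apply (linear_plus _ (Lop_linear (dM x))). }
  unfold e; rewrite (linear_minus _ _ _ (Lop_linear S)).
  vec (CompleteNormedModule.NormedModule R_AbsRing Y). }
transitivity (inner e (S e) - inner e (dM x (g x u))); [apply inner_minus_r|].
rewrite skew_adjoint_inner, inner_sym, !adjointP by exact HS.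
change (adjoint (g x) (adjoint (dM x) e)) with u.
rewrite inner_norm; ring.
Qed.

(** At [0] the range condition bounds the adjoint of [dM(0) g(0)] from below, and
    operators close to it inherit the bound. *)
Lemma feedback_coercive_near_0 :
  continuous g zero -> continuous dM zero ->
  (forall y : Y, exists u : U, dM zero (g zero u) = y) ->
  exists r c, 0 < r /\ 0 < c /\ forall x z, norm (x : X) < r ->
    c * norm (minus z (M x) : Y) <= norm (feedback g M dM x z).
Proof.
intros Hg HdM Hrange.
set (B := fun x => Lop_comp (dM x) (g x)).
destruct (adjoint_bounded_below (B zero) Hrange) as [c [Hc Hlow]].
assert (continuous B zero) as HB by exact (continuous_Lop_comp (E0 := X) dM g zero HdM Hg).
destruct (proj1 (continuous_norm_iff B zero) HB (c / 2) ltac:(lra)) as [r [Hr Hnear]].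
exists r, (c / 2); split; [exact Hr|]; split; [lra|]; intros x z Hx.
set (e := minus z (M x) : Y).
assert (opnorm (minus (B x) (B zero)) < c / 2) as HBx.
{ apply Hnear.
  norm_as (CompleteNormedModule.NormedModule R_AbsRing X) (x : X); exact Hx. }
replace (feedback g M dM x z) with (adjoint (B x) e) by apply adjoint_comp.
pose proof (Hlow e) as H1.
pose proof (norm_adjoint_minus_le (B x) (B zero) e) as H2.
pose proof (norm_le_minus (E := U) (adjoint (B zero) e) (adjoint (B x) e)) as H3.
assert (norm (minus (adjoint (B zero) e) (adjoint (B x) e) : U)
  = norm (minus (adjoint (B x) e) (adjoint (B zero) e) : U)) as H4
  by apply (norm_minus_sym (E := U)).
assert (0 <= norm e) as He by apply norm_ge_0.
apply Rlt_le, (Rmult_le_compat_r _ _ _ He) in HBx.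
lra.
Qed.

(** The weight [beta] of the graph error is the input gain of [V]: the error then
    contributes [- 2 * beta * |u|^2], half of which compensates the input term of [V] and the
    other half dominates [c^2 * beta * |e|^2]. *)
Lemma closed_loop_dissipation (V : X -> R_NormedModule) (dV : X -> Lop X R_NormedModule)
  (alpha beta c : R) (p : XY) :
  adjoint S = opp S -> invariant_graph DA A f C h S M dM ->
  filterdiff V (locally (fst p)) (dV (fst p)) -> DA (fst p) -> 0 < beta -> 0 < c ->
  0 <= V (fst p) ->
  (forall u, dV (fst p) (plus (plus (A (fst p)) (f (fst p))) (g (fst p) u))
     <= - alpha * V (fst p) + beta * norm u ^ 2) ->
  c * norm (minus (snd p) (M (fst p)) : Y) <= norm (feedback g M dM (fst p) (snd p)) ->
  dini_le (fun k => graph_lyapunov V M beta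
      (plus p (scal k (plus ((A (fst p), C (fst p)) : XY)
        (closed_loop_nonlinearity f g h S M dM p : XY))))) 0
    (- Rmin alpha (c ^ 2) * graph_lyapunov V M beta p).
Proof.
intros HS HM HV Hp Hbeta Hc HVp Hiss Hcoer; destruct p as [x z]; cbn [fst snd] in *.
set (u := feedback g M dM x z) in *.
set (d := plus ((A x, C x) : XY) (closed_loop_nonlinearity f g h S M dM (x, z) : XY)).
assert (filterdiff M (locally x) (dM x)) as HMx by apply HM.
apply dini_le_weaken with (2 := graph_lyapunov_dini V dV M dM beta (x, z) d Hbeta HV HMx).
pose proof (graph_error_dissipation x z HS HM Hp) as He; cbv zeta in He; fold u in He.
set (v := plus (A x) (plus (f x) (g x u)) : X).
set (i := inner (minus z (M x)) (minus (plus (C x) (plus (S z) (h x))) (dM x v))).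
change (i = - norm u ^ 2) in He.
change (dV x v + beta * (2 * i)
  <= - Rmin alpha (c ^ 2) * (V x + beta * norm (minus z (M x) : Y) ^ 2)).
specialize (Hiss u).
replace (plus (plus (A x) (f x)) (g x u)) with v in Hiss by apply plus_assoc.
set (e := norm (minus z (M x) : Y)) in *.
assert (0 <= e) as He0 by apply norm_ge_0.
assert ((c * e) ^ 2 <= norm u ^ 2) as Hsq
  by (apply pow_incr; split; [apply Rmult_le_pos; lra|exact Hcoer]).
rewrite Rpow_mult_distr in Hsq.
apply (Rmult_le_compat_l beta) in Hsq; [|lra].
pose proof (Rmult_le_compat_r _ _ _ HVp (Rmin_l alpha (c ^ 2))) as H1.
assert (0 <= beta * e ^ 2) as Hbe by (apply Rmult_le_pos; [lra|apply pow2_ge_0]).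
pose proof (Rmult_le_compat_r _ _ _ Hbe (Rmin_r alpha (c ^ 2))) as H2.
rewrite He; lra.
Qed.

End ClosedLoop.

Section Equivalence.
Context {X Y : HilbertSpace}.
Local Notation XY := (prod_NormedModule R_AbsRing X Y).

Lemma graph_lyapunov_equivalent (V : X -> R) (M : X -> Y) (m1 m2 k beta : R) (p : XY) :
  0 < m1 -> 0 <= m2 -> 0 < beta -> 0 <= k ->
  m1 * norm (fst p) ^ 2 <= V (fst p) <= m2 * norm (fst p) ^ 2 ->
  norm (M (fst p)) <= k * norm (fst p) ->
  norm p ^ 2 <= ((1 + 2 * k ^ 2) / m1 + 2 / beta) * graph_lyapunov V M beta p /\
  graph_lyapunov V M beta p <= (m2 + 2 * beta * (1 + k ^ 2)) * norm p ^ 2.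
Proof.
intros Hm1 Hm2 Hbeta Hk [HV1 HV2] HM.
assert (norm p ^ 2 = norm (fst p) ^ 2 + norm (snd p) ^ 2) as -> by apply norm2_prod.
unfold graph_lyapunov; set (e := minus (snd p) (M (fst p)) : Y).
assert (norm (snd p) <= norm e + norm (M (fst p))) as H1.
{ rewrite Rplus_comm; apply (norm_le_minus (E := Y)). }
assert (norm e <= norm (snd p) + norm (M (fst p))) as H2 by apply (norm_minus_le (E := Y)).
assert (0 <= norm (fst p)) as Hx by apply norm_ge_0.
assert (0 <= norm (snd p)) as Hz by apply norm_ge_0.
assert (0 <= norm e) as He by apply norm_ge_0.
set (x := norm (fst p)) in *; set (z := norm (snd p)) in *; set (n := norm e) in *.
assert (forall a b c : R, 0 <= a -> a <= b + c -> a ^ 2 <= 2 * b ^ 2 + 2 * c ^ 2) as Hsq.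
{ intros a b c Ha Hbc; assert (a ^ 2 <= (b + c) ^ 2) by (apply pow_incr; lra).
  pose proof (pow2_ge_0 (b - c)); lra. }
assert (z ^ 2 <= 2 * n ^ 2 + 2 * (k * x) ^ 2) as Hz2 by (apply Hsq; lra).
assert (n ^ 2 <= 2 * z ^ 2 + 2 * (k * x) ^ 2) as Hn2 by (apply Hsq; lra).
rewrite Rpow_mult_distr in Hz2, Hn2.
pose proof (pow2_ge_0 x); pose proof (pow2_ge_0 z); pose proof (pow2_ge_0 n);
  pose proof (pow2_ge_0 k).
split.
- assert (x ^ 2 <= V (fst p) / m1) as H7.
  { apply (Rmult_le_reg_l m1); [exact Hm1|].
    replace (m1 * (V (fst p) / m1)) with (V (fst p)) by (field; lra); exact HV1. }
  replace (((1 + 2 * k ^ 2) / m1 + 2 / beta) * (V (fst p) + beta * n ^ 2))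
    with ((1 + 2 * k ^ 2) * (V (fst p) / m1) + 2 / beta * V (fst p)
      + (1 + 2 * k ^ 2) / m1 * (beta * n ^ 2) + 2 * n ^ 2) by (field; lra).
  assert ((1 + 2 * k ^ 2) * x ^ 2 <= (1 + 2 * k ^ 2) * (V (fst p) / m1))
    by (apply Rmult_le_compat_l; lra).
  assert (0 <= V (fst p)) as HV0 by (apply Rle_trans with (2 := HV1), Rmult_le_pos; lra).
  assert (0 <= 2 / beta * V (fst p))
    by (apply Rmult_le_pos; [apply Rlt_le, Rdiv_lt_0_compat|]; lra).
  assert (0 <= (1 + 2 * k ^ 2) / m1 * (beta * n ^ 2))
    by (apply Rmult_le_pos; [apply Rlt_le, Rdiv_lt_0_compat|apply Rmult_le_pos]; lra).
  lra.
- apply (Rmult_le_compat_l beta) in Hn2; [|lra].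
  assert (0 <= m2 * z ^ 2) by (apply Rmult_le_pos; lra).
  assert (0 <= beta * (k ^ 2 * z ^ 2)) by (repeat apply Rmult_le_pos; lra).
  assert (0 <= beta * x ^ 2) by (apply Rmult_le_pos; lra).
  lra.
Qed.

End Equivalence.

(** * Local exponential stability *)

Theorem theorem2 (X U Y : HilbertSpace)
  (DA : X -> Prop) (A : X -> X) (f : X -> X) (g : X -> Lop U X)
  (h : X -> Y) (C : X -> Y) (S : Lop Y Y)
  (HA : C0_generator DA A)
  (Hf : locally_lipschitz f) (Hf0 : f zero = zero)
  (Hg : locally_lipschitz g)
  (Hh : locally_lipschitz h) (Hh0 : h zero = zero)
  (HC : graph_bounded_linear DA A C)
  (HS : adjoint S = opp S)
  (HISS : semiglobal_ISS DA A f g)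
  (M : X -> Y) (dM : X -> Lop X Y)
  (HM : invariant_graph DA A f C h S M dM)
  (Hrange : forall y : Y, exists u : U, dM zero (g zero u) = y) :
  zero_locally_exponentially_stable (closed_loop_solution DA A f g C h S M dM).
Proof.
set (XY := prod_NormedModule R_AbsRing X Y).
destruct HA as [TX [HTX HAX]].
pose proof HM as [HMC1 [_ [HM0 _]]].
destruct HISS as [_ HISS].
destruct (HISS (fun x => norm x < 1)) as
  [V [dV [alpha [beta [HV [[m1 [m2 [Hm1 [Hm2 HVq]]]] [Halpha [Hbeta Hdiss]]]]]]]].
{ exists 1; intros x Hx; lra. }
{ intros x Hx; apply (locally_norm_iff (E := X)); exists (1 - norm x); split; [lra|].
  intros y Hy; pose proof (norm_le_minus (E := X) y x) as H.
  apply Rle_lt_trans with (1 := H); lra. }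
assert (forall x, continuous g x) as Hgc
  by (intros x; exact (locally_lipschitz_continuous g x Hg)).
destruct (feedback_coercive_near_0 g M dM (Hgc zero) (proj2 HMC1 zero) Hrange)
  as [rc [c [Hrc [Hc Hcoer]]]].
destruct (C1_lipschitz_near M dM zero HMC1) as [rM [k [HrM [Hk HMlip]]]].
set (r0 := Rmin 1 (Rmin rc rM)).
assert (0 < r0) as Hr0 by (unfold r0; repeat apply Rmin_pos; lra).
assert (r0 <= 1) as Hr01 by apply Rmin_l.
assert (r0 <= rc) as Hr0c by (eapply Rle_trans; [apply Rmin_r|apply Rmin_l]).
assert (r0 <= rM) as Hr0M by (eapply Rle_trans; [apply Rmin_r|apply Rmin_r]).
set (omega := Rmin alpha (c ^ 2)).
assert (0 < omega) as Homega by (apply Rmin_pos; [lra|apply pow_lt; lra]).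
set (W := graph_lyapunov V M beta : XY -> R).
set (k1 := (1 + 2 * k ^ 2) / m1 + 2 / beta).
set (k2 := m2 + 2 * beta * (1 + k ^ 2)).
assert (0 <= k ^ 2) as Hksq by apply pow2_ge_0.
assert (0 < k1) as Hk1
  by (apply Rplus_lt_0_compat; apply Rdiv_lt_0_compat; lra).
assert (0 < k2) as Hk2
  by (apply Rplus_lt_0_compat; [lra|apply Rmult_lt_0_compat; lra]).
assert (forall p : XY, norm (fst p) < r0 -> norm p ^ 2 <= k1 * W p /\ W p <= k2 * norm p ^ 2)
  as Hequiv.
{ intros p Hp; apply graph_lyapunov_equivalent; try lra; [apply HVq|].
  assert (norm (minus (fst p) zero : X) = norm (fst p)) as Hn0.
  { f_equal; vec (CompleteNormedModule.NormedModule R_AbsRing X). }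
  rewrite <- Hn0.
  apply Rle_trans with (norm (minus (M (fst p)) (M zero) : Y)).
  { right; f_equal; transitivity (minus (M (fst p)) zero : Y).
    - vec (CompleteNormedModule.NormedModule R_AbsRing Y).
    - f_equal; symmetry; exact HM0. }
  apply HMlip; [|rewrite norm_minus_diag; exact HrM].
  apply Rle_lt_trans with (norm (fst p)); [right; exact Hn0|lra]. }
assert (forall p : XY, m1 * norm (fst p) ^ 2 <= W p) as HWV.
{ intros p; apply Rle_trans with (1 := proj1 (HVq (fst p))).
  rewrite <- Rplus_0_r at 1; apply Rplus_le_compat_l, Rmult_le_pos; [lra|apply pow2_ge_0]. }
assert (forall p : XY, exists r L, 0 < r /\ 0 <= L /\ forall y z : XY,
  norm (minus y p) < r -> norm (minus z p) < r -> W y - W z <= L * norm (minus y z)) as HWlip.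
{ intros p; apply graph_lyapunov_lipschitz; [lra| |].
  - exact (C1_lipschitz_near V dV (fst p) HV).
  - exact (C1_lipschitz_near M dM (fst p) HMC1). }
(* as [q ^ 2 <= q], starting in the ball of radius [r0 * q] gives
   [W (w 0) < k2 * (r0 * q) ^ 2 <= m1 * r0 ^ 2], a sublevel set where [norm x < r0] *)
set (q := Rmin 1 (m1 / k2)).
assert (0 < m1 / k2) as Hmk by (apply Rdiv_lt_0_compat; lra).
assert (0 < q) as Hq by (apply Rmin_pos; lra).
assert (q <= 1) as Hq1 by apply Rmin_l.
assert (k2 * q <= m1) as Hqk.
{ apply Rle_trans with (k2 * (m1 / k2)); [|right; field; lra].
  apply Rmult_le_compat_l; [lra|apply Rmin_r]. }
(* [1 + k1 * k2] is above the natural constant, the square root of [k1 * k2] *)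
exists (r0 * q), (1 + k1 * k2), (omega / 2).
split; [apply Rmult_lt_0_compat; lra|].
split; [pose proof (Rmult_lt_0_compat _ _ Hk1 Hk2); lra|].
split; [lra|].
intros w [Hw [T [HT [HAT Hmild]]]] Hw0 t Ht.
change (R -> XY) in (type of w).
assert (norm (fst (w 0)) <= norm (w 0)) as Hfst0 by exact (norm_fst_le (w 0 : XY)).
assert (0 <= norm (w 0 : XY)) as Hn0 by apply norm_ge_0.
assert (norm (fst (w 0)) < r0) as Hx0.
{ apply Rle_lt_trans with (1 := Hfst0), Rlt_le_trans with (1 := Hw0).
  rewrite <- (Rmult_1_r r0) at 2; apply Rmult_le_compat_l; lra. }
assert (forall s, 0 <= s -> W (w s) < m1 * r0 ^ 2 -> norm (fst (w s)) < r0) as Hsub.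
{ intros s Hs HWs; apply Rnot_le_lt; intros Hle.
  assert (r0 ^ 2 <= norm (fst (w s)) ^ 2) as H by (apply pow_incr; lra).
  apply (Rmult_le_compat_l m1) in H; [|lra].
  pose proof (HWV (w s)); lra. }
destruct (exponential_decay_in_sublevel (fun s => W (w s)) omega (m1 * r0 ^ 2))
  with (t := t) as [Hdecay Hin]; try assumption.
- intros s Hs; apply Rle_trans with (2 := HWV (w s)).
  apply Rmult_le_pos; [lra|apply pow2_ge_0].
- apply Rle_lt_trans with (1 := proj2 (Hequiv (w 0) Hx0)).
  apply Rlt_le_trans with (k2 * (r0 * q) ^ 2).
  + apply Rmult_lt_compat_l; [exact Hk2|].
    simpl; rewrite !Rmult_1_r; apply Rmult_le_0_lt_compat; assumption.
  + replace (k2 * (r0 * q) ^ 2) with (k2 * q * (q * r0 ^ 2)) by ring.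
    pose proof (pow2_ge_0 r0).
    apply Rmult_le_compat; try nra.
- intros s Hs eps Heps.
  destruct (HWlip (w s)) as [r [L [Hr [HL HWL]]]].
  assert (0 < eps / (L + 1)) as He by (apply Rdiv_lt_0_compat; lra).
  destruct (proj1 (continuous_on_nonneg_iff w) Hw s ltac:(lra) _ (Rmin_pos _ _ Hr He))
    as [eta [Heta Hcont]].
  exists eta; split; [exact Heta|]; intros s' Hs' Hss.
  specialize (Hcont s' ltac:(lra) ltac:(rewrite Rabs_minus_sym, Rabs_pos_eq; lra)).
  pose proof (Rmin_l r (eps / (L + 1))); pose proof (Rmin_r r (eps / (L + 1))).
  assert (W (w s) - W (w s') <= L * norm (minus (w s) (w s') : XY)) as H1
    by (apply HWL; [rewrite norm_minus_diag; exact Hr|exact (Rlt_le_trans _ _ _ Hcont H)]).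
  assert (norm (minus (w s) (w s') : XY) <= eps / (L + 1)) as H2.
  { rewrite norm_minus_sym; apply Rlt_le, Rlt_le_trans with (1 := Hcont); assumption. }
  assert (L * norm (minus (w s) (w s') : XY) <= (L + 1) * (eps / (L + 1))) as H3.
  { apply Rmult_le_compat; [lra|apply norm_ge_0|lra|exact H2]. }
  replace ((L + 1) * (eps / (L + 1))) with eps in H3 by (field; lra).
  lra.
- intros s Hs HWs.
  apply (decay_along_mild (E := XY) T (fun p => DA (fst p)) (fun p => (A (fst p), C (fst p)))
    (closed_loop_nonlinearity f g h S M dM) W w omega s (fun p => norm (fst p) < r0));
    try assumption; try lra.
  + apply prod_sequentially_complete; apply complete_sequentially.
  + intros [x z] eps Heps.
    destruct (generator_domain_dense (E := X) TX DA A HTX HAX x eps Heps) as [y [Hy Hyx]].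
    exists (y, z); split; [exact Hy|].
    apply Rle_lt_trans with (1 := norm_prod_le _).
    change (norm (minus y x : X) + norm (minus z z : Y) < eps).
    assert (norm (minus z z : Y) = 0) as -> by exact (norm_minus_diag (E := Y) z).
    rewrite Rplus_0_r; exact Hyx.
  + apply closed_loop_nonlinearity_continuous; intros x.
    * exact (locally_lipschitz_continuous f x Hf).
    * apply Hgc.
    * exact (locally_lipschitz_continuous h x Hh).
    * exact (lipschitz_near_continuous M x (C1_lipschitz_near M dM x HMC1)).
    * exact (proj2 HMC1 x).
  + apply HWlip.
  + pose proof (Hsub s Hs HWs) as Hxs.
    apply (locally_norm_iff (E := XY)); exists (r0 - norm (fst (w s))); split; [lra|].
    intros p Hp.
    pose proof (norm_le_minus (E := X) (fst p) (fst (w s))) as H1.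
    pose proof (norm_fst_le (minus p (w s) : XY)) as H2.
    change (norm (minus (fst p) (fst (w s)) : X) <= norm (minus p (w s) : XY)) in H2.
    apply Rle_lt_trans with (1 := H1).
    apply Rle_lt_trans with (norm (fst (w s)) + norm (minus p (w s) : XY)); [|lra].
    apply Rplus_le_compat_l; exact H2.
  + intros p Hp HpG.
    apply (closed_loop_dissipation DA A f g C h S M dM V dV alpha beta c p HS HM);
      try assumption.
    * apply HV.
    * apply Rle_trans with (2 := proj1 (HVq (fst p))).
      apply Rmult_le_pos; [lra|apply pow2_ge_0].
    * intros u; apply Hdiss; [exact Hp|apply Rlt_le_trans with (1 := HpG); exact Hr01].
    * apply Hcoer; apply Rlt_le_trans with (1 := HpG); exact Hr0c.
- destruct (Hequiv (w t) (Hsub t Ht Hin)) as [Hlow _].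
  destruct (Hequiv (w 0) Hx0) as [_ Hup].
  set (n := norm (w t : XY)) in *; set (n0 := norm (w 0 : XY)) in *.
  set (x := exp (- (omega / 2) * t)).
  assert (0 < x) as Hx by apply exp_pos.
  assert (x * x * exp (omega * t) = 1) as Hxx.
  { unfold x; rewrite <- !exp_plus, <- exp_0; f_equal; field. }
  assert (n ^ 2 <= ((1 + k1 * k2) * x * n0) ^ 2) as H.
  { assert (W (w t) <= x * x * (k2 * n0 ^ 2)) as H1.
    { replace (W (w t)) with (x * x * (exp (omega * t) * W (w t)))
        by (rewrite <- Rmult_assoc, Hxx; ring).
      apply Rmult_le_compat_l; [nra|lra]. }
    apply (Rmult_le_compat_l k1) in H1; [|lra].
    pose proof (Rmult_lt_0_compat _ _ Hk1 Hk2) as Hkk.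
    apply Rle_trans with (k1 * k2 * (x * n0) ^ 2); [nra|].
    replace (((1 + k1 * k2) * x * n0) ^ 2) with ((1 + k1 * k2) ^ 2 * (x * n0) ^ 2) by ring.
    apply Rmult_le_compat_r; [apply pow2_ge_0|nra]. }
  apply Rsqr_incr_0_var.
  + unfold Rsqr; lra.
  + repeat apply Rmult_le_pos; try lra.
    pose proof (Rmult_lt_0_compat _ _ Hk1 Hk2); lra.
Qed.
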